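(* (a) For each fixed $\tau_0\in C_+(\Omega)$, the set $\{\phi\in BUC^1_\alpha:(\phi,\tau_0)\in D_\alpha\}$ is dense in $BUC_\alpha$; consequently $\overline{D_\alpha}=BUC_\alpha\times C_+(\Omega)$ in $BUC_\alpha\times C_+(\Omega)$. (b) $D_\alpha$ is positively invariant under the semiflow $\mathcal U$ of system (1.1): for each $(\varphi,\tau_0)\in D_\alpha$, $\mathcal U(t)(\varphi,\tau_0)\in D_\alpha$ for all $t\in[0,T_{BU}(\varphi,\tau_0))$. (c) The restriction of $\mathcal U$ to $D_\alpha$ is a continuous semiflow, i.e. $(t,W_0)\mapsto \mathcal U(t)W_0$ is continuous from $\{(t,W_0): W_0\in D_\alpha,\ 0\le t<T_{BU}(W_0)\}$ into $(D_\alpha,d_{D_\alpha})$.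
   Context: $\Omega\subset\mathbb R^n$ compact, $C(\Omega)$ with sup norm, $C_+(\Omega)$ its nonnegative cone, $\alpha\ge0$ fixed. Standing assumption: $F:C(\Omega)\times C(\Omega)\times C(\Omega^2)\to C(\Omega)$ is Lipschitz on bounded sets; $f:C(\Omega)\to C(\Omega)$ is Lipschitz, $0<f(\phi)(x)\le M_f$ for a constant $M_f$, and $f$ is non-increasing for the pointwise order. $BUC_\alpha$ is the space of $\phi\in C((-\infty,0],C(\Omega))$ with $\phi_\alpha(t):=e^{-\alpha|t|}\phi(t,\cdot)$ bounded and uniformly continuous, norm $\sup_{t\le0}\|\phi_\alpha(t)\|_\infty$. $BUC^1_\alpha$ is the space of $\phi\in C^1((-\infty,0],C(\Omega))$ with $\phi_\alpha$ and $\partial_t\phi_\alpha$ bounded uniformly continuous, norm $\|\phi_\alpha\|_\infty+\|\partial_t\phi_\alpha\|_\infty$. $$D_\alpha:=\{(\phi,\tau_0)\in BUC^1_\alpha\times C_+(\Omega):\ \phi'(0,x)=F(\phi(0,\cdot),\tau_0,\phi(-\tau_0(\cdot),\cdot))(x)\ \forall x\in\Omega\},$$ where $\phi(-\tau_0(\cdot),\cdot)\in C(\Omega^2)$ is $(x,y)\mapsto\phi(-\tau_0(x),y)$, with metric $d_{D_\alpha}((\phi,\tau_0),(\hat\phi,\hat\tau_0))=\|\phi-\hat\phi\|_{BUC^1_\alpha}+\|\tau_0-\hat\tau_0\|_\infty$. $\mathcal U$ is the semiflow of system (1.1): for $(\varphi,\tau_0)$, $\mathcal U(t)(\varphi,\tau_0)=(A_t,\tau(t,\cdot))$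 where $(A,\tau)$ is the unique maximal solution, i.e. continuous $A:(-\infty,T_{BU})\to C(\Omega)$, $\tau:[0,T_{BU})\to C_+(\Omega)$ with $A=\varphi$ on $(-\infty,0]$, $A(t,x)=\varphi(0,x)+\int_0^tF(A(l,\cdot),\tau(l,\cdot),A(l-\tau(l)))(x)dl$ (where $A(l-\tau(l))(x,y)=A(l-\tau(l,x),y)$), and $\int_{t-\tau(t,x)}^tf(A(s,\cdot))(x)ds=\int_{-\tau_0(x)}^0f(\varphi(s,\cdot))(x)ds$; $A_t(\theta)=A(t+\theta)$, and $T_{BU}(\varphi,\tau_0)$ is the maximal existence time. *)

(* Defs.v *)
From Stdlib Require Import Reals Lra Classical.
Open Scope R_scope.

Definition pt := nat -> R.
Definition in_Rn (n : nat) (x : pt) : Prop := forall i, (n <= i)%nat -> x i = 0.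
Definition near (n : nat) (x y : pt) (d : R) : Prop :=
  forall i, (i < n)%nat -> Rabs (x i - y i) < d.

Definition seq_compact (n : nat) (Om : pt -> Prop) : Prop :=
  forall u : nat -> pt, (forall k, Om (u k)) ->
  exists (phi : nat -> nat) (l : pt),
    (forall k, (phi k < phi (S k))%nat) /\ Om l /\
    forall eps, eps > 0 -> exists N, forall k, (N <= k)%nat -> near n (u (phi k)) l eps.

Definition Omega_hyp (n : nat) (Om : pt -> Prop) : Prop :=
  (forall x, Om x -> in_Rn n x) /\ seq_compact n Om.

(** Elements of C(Omega) are represented by functions pt -> R (values off
    Omega are irrelevant); elements of C(Omega^2) by pt -> pt -> R. *)
Definition contOn (n : nat) (Om : pt -> Prop) (u : pt -> R) : Prop :=
  forall x, Om x -> forall eps, eps > 0 -> exists d, d > 0 /\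
    forall y, Om y -> near n y x d -> Rabs (u y - u x) < eps.

Definition contOn2 (n : nat) (Om : pt -> Prop) (w : pt -> pt -> R) : Prop :=
  forall x y, Om x -> Om y -> forall eps, eps > 0 -> exists d, d > 0 /\
    forall x' y', Om x' -> Om y' -> near n x' x d -> near n y' y d ->
      Rabs (w x' y' - w x y) < eps.

Definition Cplus (n : nat) (Om : pt -> Prop) (u : pt -> R) : Prop :=
  contOn n Om u /\ forall x, Om x -> 0 <= u x.

Definition suple (Om : pt -> Prop) (u : pt -> R) (r : R) : Prop :=
  forall x, Om x -> Rabs (u x) <= r.
Definition suple2 (Om : pt -> Prop) (w : pt -> pt -> R) (r : R) : Prop :=
  forall x y, Om x -> Om y -> Rabs (w x y) <= r.

Definition Ftype := (pt -> R) -> (pt -> R) -> (pt -> pt -> R) -> (pt -> R).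

Definition F_hyp (n : nat) (Om : pt -> Prop) (F : Ftype) : Prop :=
  (forall u t w, contOn n Om u -> contOn n Om t -> contOn2 n Om w ->
     contOn n Om (F u t w)) /\
  (forall K, exists L, forall u t w u' t' w' a b c,
     contOn n Om u -> contOn n Om t -> contOn2 n Om w ->
     contOn n Om u' -> contOn n Om t' -> contOn2 n Om w' ->
     suple Om u K -> suple Om t K -> suple2 Om w K ->
     suple Om u' K -> suple Om t' K -> suple2 Om w' K ->
     suple Om (fun x => u x - u' x) a ->
     suple Om (fun x => t x - t' x) b ->
     suple2 Om (fun x y => w x y - w' x y) c ->
     suple Om (fun x => F u t w x - F u' t' w' x) (L * (a + b + c))).

Definition f_hyp (n : nat) (Om : pt -> Prop) (f : (pt -> R) -> (pt -> R)) (Mf : R) : Prop :=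
  (forall u, contOn n Om u -> contOn n Om (f u)) /\
  (exists L, forall u v a, contOn n Om u -> contOn n Om v ->
     suple Om (fun x => u x - v x) a ->
     suple Om (fun x => f u x - f v x) (L * a)) /\
  (forall u x, contOn n Om u -> Om x -> 0 < f u x <= Mf) /\
  (forall u v, contOn n Om u -> contOn n Om v ->
     (forall x, Om x -> u x <= v x) -> forall x, Om x -> f v x <= f u x).

Definition Ineg (t : R) : Prop := t <= 0.

Definition contC (n : nat) (Om : pt -> Prop) (I : R -> Prop) (phi : R -> pt -> R) : Prop :=
  (forall t, I t -> contOn n Om (phi t)) /\
  (forall t, I t -> forall eps, eps > 0 -> exists d, d > 0 /\
     forall s, I s -> Rabs (s - t) < d -> suple Om (fun x => phi s x - phi t x) eps).

Definition BUCfun (n : nat) (Om : pt -> Prop) (psi : R -> pt -> R) : Prop :=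
  (forall t, t <= 0 -> contOn n Om (psi t)) /\
  (exists M, forall t, t <= 0 -> suple Om (psi t) M) /\
  (forall eps, eps > 0 -> exists d, d > 0 /\
     forall s t, s <= 0 -> t <= 0 -> Rabs (s - t) < d ->
       suple Om (fun x => psi s x - psi t x) eps).

Definition wt (alpha : R) (phi : R -> pt -> R) : R -> pt -> R :=
  fun t x => exp (- alpha * Rabs t) * phi t x.

(** d/dt phi_alpha on (-oo,0] given phi' = dphi (product rule, since
    d/dt e^{-alpha|t|} = alpha e^{-alpha|t|} for t <= 0, one-sided at 0). *)
Definition dwt (alpha : R) (phi dphi : R -> pt -> R) : R -> pt -> R :=
  fun t x => alpha * exp (- alpha * Rabs t) * phi t x + exp (- alpha * Rabs t) * dphi t x.

Definition BUC (n : nat) (Om : pt -> Prop) (alpha : R) (phi : R -> pt -> R) : Prop :=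
  contC n Om Ineg phi /\ BUCfun n Om (wt alpha phi).

Definition hasDeriv (Om : pt -> Prop) (I : R -> Prop) (phi dphi : R -> pt -> R) : Prop :=
  forall t, I t -> forall eps, eps > 0 -> exists d, d > 0 /\
    forall h, h <> 0 -> Rabs h < d -> I (t + h) ->
      suple Om (fun x => (phi (t + h) x - phi t x) / h - dphi t x) eps.

Definition BUC1 (n : nat) (Om : pt -> Prop) (alpha : R) (phi dphi : R -> pt -> R) : Prop :=
  contC n Om Ineg phi /\ hasDeriv Om Ineg phi dphi /\ contC n Om Ineg dphi /\
  BUCfun n Om (wt alpha phi) /\ BUCfun n Om (dwt alpha phi dphi).

Definition delayed (phi : R -> pt -> R) (tau0 : pt -> R) : pt -> pt -> R :=
  fun x y => phi (- tau0 x) y.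

Definition InD (n : nat) (Om : pt -> Prop) (F : Ftype) (alpha : R)
  (phi : R -> pt -> R) (tau0 : pt -> R) : Prop :=
  exists dphi, BUC1 n Om alpha phi dphi /\ Cplus n Om tau0 /\
    forall x, Om x -> dphi 0 x = F (phi 0) tau0 (delayed phi tau0) x.

Definition dBUC_lt (Om : pt -> Prop) (alpha : R) (phi psi : R -> pt -> R) (eps : R) : Prop :=
  exists a, a < eps /\
    forall t, t <= 0 -> suple Om (fun x => wt alpha phi t x - wt alpha psi t x) a.

Definition dC_lt (Om : pt -> Prop) (u v : pt -> R) (eps : R) : Prop :=
  exists a, a < eps /\ suple Om (fun x => u x - v x) a.

Definition dD_lt (Om : pt -> Prop) (alpha : R) (phi : R -> pt -> R) (tau : pt -> R)
  (phi' : R -> pt -> R) (tau' : pt -> R) (eps : R) : Prop :=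
  forall dphi dphi', hasDeriv Om Ineg phi dphi -> hasDeriv Om Ineg phi' dphi' ->
  exists a b c, a + b + c < eps /\
    (forall t, t <= 0 -> suple Om (fun x => wt alpha phi t x - wt alpha phi' t x) a) /\
    (forall t, t <= 0 ->
       suple Om (fun x => dwt alpha phi dphi t x - dwt alpha phi' dphi' t x) b) /\
    suple Om (fun x => tau x - tau' x) c.

Definition Tlt (t : R) (T : option R) : Prop :=
  match T with Some T0 => t < T0 | None => True end.
Definition Tle (T1 T2 : option R) : Prop :=
  match T1, T2 with
  | _, None => True
  | None, Some _ => False
  | Some a, Some b => a <= b
  end.

Definition is_solution (n : nat) (Om : pt -> Prop) (F : Ftype) (f : (pt -> R) -> (pt -> R))
  (phi : R -> pt -> R) (tau0 : pt -> R) (A tau : R -> pt -> R) (T : option R) : Prop :=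
  Tlt 0 T /\
  (forall t x, t <= 0 -> Om x -> A t x = phi t x) /\
  contC n Om (fun t => Tlt t T) A /\
  contC n Om (fun t => 0 <= t /\ Tlt t T) tau /\
  (forall t x, 0 <= t -> Tlt t T -> Om x -> 0 <= tau t x) /\
  (forall t x, 0 <= t -> Tlt t T -> Om x ->
     exists pr : Riemann_integrable
                   (fun l => F (A l) (tau l) (fun y z => A (l - tau l y) z) x) 0 t,
       A t x = phi 0 x + RiemannInt pr) /\
  (forall t x, 0 <= t -> Tlt t T -> Om x ->
     exists (pr1 : Riemann_integrable (fun s => f (A s) x) (t - tau t x) t)
            (pr2 : Riemann_integrable (fun s => f (phi s) x) (- tau0 x) 0),
       RiemannInt pr1 = RiemannInt pr2).

(** The maximal solution; T is then T_BU(phi, tau0). *)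
Definition max_solution (n : nat) (Om : pt -> Prop) (F : Ftype) (f : (pt -> R) -> (pt -> R))
  (phi : R -> pt -> R) (tau0 : pt -> R) (A tau : R -> pt -> R) (T : option R) : Prop :=
  is_solution n Om F f phi tau0 A tau T /\
  forall A' tau' T', is_solution n Om F f phi tau0 A' tau' T' -> Tle T' T.

Definition shift (A : R -> pt -> R) (t : R) : R -> pt -> R := fun th => A (t + th).

(* Main.v *)
From Stdlib Require Import Reals Lra Lia Classical ClassicalEpsilon.
From Coquelicot Require Import Coquelicot.
Require Import Defs.
Open Scope R_scope.

(** Density: smooth the weighted history [e^(-alpha |t|) psi] by Steklov averages, then add
    [k sin (t / k) c(x)] with [k] small to prescribe the derivative at [0]; the compatibility
    condition becomes a fixed point equation for [c], solved by contraction.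

    Invariance: for [t > 0] the solution is an integral of the continuous function
    [t |-> F (A t) (tau t) (A (t - tau t))], and the compatibility condition says precisely that
    this function matches [phi'] at [0], so [A] is C^1 on the whole of [(-oo, T)].

    Continuity: since [A] is C^1 it is Lipschitz on compact intervals, which controls the
    state-dependent delayed term.  Since [f] is non-increasing, it is bounded below on bounded sets,
    so the integral equation for [tau] makes the delay Lipschitz in the data.  A Gronwall argument
    then gives Lipschitz dependence of [A], its derivative and [tau] on the initial data over
    [[0, t1]], and the shift is continuous in time by uniform continuity of the weighted solution.
    No existence theory is required: only times at which both solutions are defined are compared. *)

(** The obstacle is the delayed argument: evaluating a history at a time that itself depends on the
    solution is Lipschitz only if the history is Lipschitz in time. The comparison therefore goes
    from [A' (l - tau')] to [A (l - tau')] and then to [A (l - tau)]. Only the reference solution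
    needs a Lipschitz constant, so every constant is fixed before the perturbed solution is
    introduced.

    The corrector k sin(t / k) works because the norm of BUC_alpha does not see slopes: its size is
    at most k, while its derivative at 0 is 1 for every k.

    Functions on Omega are represented by functions on all of [pt], so two of them that agree on
    [Om] need not be equal. Equations are therefore asserted on [Om] only, and replacing an argument
    of [F] or [f] by one that agrees with it on [Om] takes a proof ([F_ext], [f_ext]). *)

(** * Compactness of intervals and estimates for integrals *)

(** A Lebesgue number argument for gauges: each point chooses its own radius, yet the radii actually
    used are bounded below. [P] need not be monotone in the radius, so a caller may store other data
    in it. *)
Lemma compact_unif (a b : R) (P : R -> R -> Prop) :
  (forall s, a <= s <= b -> exists d, d > 0 /\ P s d) ->
  exists d, d > 0 /\ forall r, a <= r <= b ->
    exists s e, a <= s <= b /\ P s e /\ Rabs (r - s) < e /\ d <= e.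
Proof.
  intros H.
  assert (Hc : forall s, exists e : posreal, a <= s <= b -> P s e).
  { intros s. destruct (classic (a <= s <= b)) as [Hs | Hs].
    - destruct (H s Hs) as [d [Hd HP]]. exists (mkposreal d Hd). intros _; exact HP.
    (* The gauge must be total; 1 is a dummy radius outside the interval. *)
    - exists (mkposreal 1 Rlt_0_1). tauto. }
  set (delta := fun s => proj1_sig (constructive_indefinite_description _ (Hc s))).
  assert (Hdelta : forall s, a <= s <= b -> P s (delta s)).
  { intros s Hs. exact (proj2_sig (constructive_indefinite_description _ (Hc s)) Hs). }
  destruct (compactness_value_1d a b delta) as [d Hd].
  exists d; split; [apply cond_pos|].
  intros r Hr. destruct (NNPP _ (Hd r Hr)) as [s [Hs [H1 H2]]].
  exists s, (delta s). auto.
Qed.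

(** Real induction: the supremum of the initial segments on which [P] holds is itself reached by the
    closedness clause, and the openness clause prevents it from lying below [b]. *)
Lemma interval_induction (b : R) (P : R -> Prop) :
  0 <= b -> P 0 ->
  (forall l, 0 <= l < b -> (forall r, 0 <= r <= l -> P r) ->
     exists d, d > 0 /\ forall r, l < r < l + d -> r <= b -> P r) ->
  (forall l, 0 < l <= b -> (forall r, 0 <= r < l -> P r) -> P l) ->
  forall r, 0 <= r <= b -> P r.
Proof.
  intros Hb P0 Hopen Hclosed.
  set (S := fun l => 0 <= l <= b /\ forall r, 0 <= r <= l -> P r).
  assert (S0 : S 0).
  { split; [lra|]. intros r Hr. replace r with 0 by lra. exact P0. }
  destruct (completeness S) as [m [Hub Hlub]].
  { exists b. intros l [Hl _]; lra. }
  { exists 0; exact S0. }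
  assert (Hm0 : 0 <= m) by (apply Hub; exact S0).
  assert (Hmb : m <= b) by (apply Hlub; intros l [Hl _]; lra).
  assert (Hbelow : forall r, 0 <= r < m -> P r).
  { intros r Hr. apply NNPP; intros Hn.
    assert (m <= r); [|lra].
    apply Hlub. intros l [Hl HPl]. destruct (Rle_lt_dec l r) as [|Hlt]; [assumption|].
    exfalso; apply Hn, HPl; lra. }
  assert (HPm : P m).
  { destruct (Req_dec m 0) as [->|]; [exact P0|]. apply Hclosed; [lra|exact Hbelow]. }
  assert (Hall : forall r, 0 <= r <= m -> P r).
  { intros r Hr. destruct (Req_dec r m) as [->|]; [exact HPm|apply Hbelow; lra]. }
  destruct (Rle_lt_or_eq_dec m b Hmb) as [Hlt|Heq].
  - exfalso. destruct (Hopen m (conj Hm0 Hlt) Hall) as [d [Hd HPd]].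
    set (m' := Rmin b (m + d / 2)).
    assert (m < m' /\ m' <= b /\ m' <= m + d / 2).
    { unfold m', Rmin; destruct (Rle_dec b (m + d / 2)); lra. }
    assert (m' <= m); [|lra].
    apply Hub. split; [lra|]. intros r Hr.
    destruct (Rle_lt_dec r m); [apply Hall; lra|apply HPd; lra].
  - intros r Hr; apply Hall; lra.
Qed.

(** The end points are unordered so that difference quotients with increments of either sign are
    covered. *)
Lemma RInt_dist_const (g : R -> R) (a b I c e : R) :
  is_RInt g a b I ->
  (forall r, Rmin a b <= r <= Rmax a b -> Rabs (g r - c) <= e) ->
  Rabs (I - c * (b - a)) <= e * Rabs (b - a).
Proof.
  assert (main : forall a b I, a <= b -> is_RInt g a b I ->
    (forall r, a <= r <= b -> Rabs (g r - c) <= e) ->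
    Rabs (I - c * (b - a)) <= e * Rabs (b - a)).
  { clear a b I. intros a b I Hab HI Hg.
    pose proof (is_RInt_minus _ _ _ _ _ _ HI (is_RInt_const a b c)) as H1.
    pose proof (is_RInt_const a b e) as H2.
    pose proof (norm_RInt_le (fun r => minus (g r) c) (fun _ => e) a b _ _ Hab Hg H1 H2) as H3.
    rewrite (Rabs_pos_eq (b - a)) by lra.
    replace (I - c * (b - a)) with (minus I (scal (b - a) c)).
    - eapply Rle_trans; [exact H3|]. right. unfold scal; simpl; unfold mult; simpl. ring.
    - unfold minus, plus, opp, scal; simpl; unfold mult; simpl; ring. }
  intros HI Hg. destruct (Rle_lt_dec a b) as [Hab|Hab].
  - rewrite Rmin_left, Rmax_right in Hg by lra. apply main; auto.
  - rewrite Rmin_right, Rmax_left in Hg by lra.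
    pose proof (main b a (- I) ltac:(lra) (is_RInt_swap _ _ _ _ HI) Hg) as H.
    rewrite <- Rabs_Ropp. rewrite (Rabs_minus_sym b a).
    replace (- (I - c * (b - a))) with (- I - c * (a - b)) by ring. exact H.
Qed.

Lemma RInt_bound (g : R -> R) (a b I M : R) :
  is_RInt g a b I ->
  (forall r, Rmin a b <= r <= Rmax a b -> Rabs (g r) <= M) ->
  Rabs I <= M * Rabs (b - a).
Proof.
  intros HI Hg. replace I with (I - 0 * (b - a)) by ring.
  apply (RInt_dist_const g); auto. intros r Hr. rewrite Rminus_0_r; auto.
Qed.

Lemma is_RInt_sub (g : R -> R) (a b c I J : R) :
  is_RInt g a b I -> is_RInt g a c J -> is_RInt g b c (J - I).
Proof.
  intros H1 H2.
  pose proof (is_RInt_Chasles _ _ _ _ _ _ (is_RInt_swap _ _ _ _ H1) H2) as H.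
  replace (J - I) with (- I + J) by ring. exact H.
Qed.

Lemma is_RInt_of_Riemann (g : R -> R) (a b : R) (pr : Riemann_integrable g a b) :
  is_RInt g a b (RiemannInt pr).
Proof.
  rewrite <- RInt_Reals. apply (RInt_correct g a b), ex_RInt_Reals_1, pr.
Qed.

Lemma strictly_increasing_ge (phi : nat -> nat) :
  (forall k, (phi k < phi (S k))%nat) -> forall k, (k <= phi k)%nat.
Proof.
  intros H. induction k as [|k IH]; [lia|]. specialize (H k). lia.
Qed.

Lemma Rabs_lt_sub (a b c e1 e2 : R) :
  Rabs (a - b) < e1 -> Rabs (b - c) < e2 -> Rabs (a - c) < e1 + e2.
Proof.
  intros. replace (a - c) with ((a - b) + (b - c)) by ring.
  eapply Rle_lt_trans; [apply Rabs_triang|lra].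
Qed.

Lemma Rabs_le_sub (a b c e1 e2 : R) :
  Rabs (a - b) <= e1 -> Rabs (b - c) <= e2 -> Rabs (a - c) <= e1 + e2.
Proof.
  intros. replace (a - c) with ((a - b) + (b - c)) by ring.
  eapply Rle_trans; [apply Rabs_triang|lra].
Qed.

Lemma Rabs_le_near (a b M e : R) : Rabs b <= M -> Rabs (a - b) <= e -> Rabs a <= M + e.
Proof.
  intros. replace a with (b + (a - b)) by ring.
  eapply Rle_trans; [apply Rabs_triang|lra].
Qed.

Lemma Rabs_mult_le (a b A B : R) : Rabs a <= A -> Rabs b <= B -> Rabs (a * b) <= A * B.
Proof.
  intros. rewrite Rabs_mult. apply Rmult_le_compat; auto; apply Rabs_pos.
Qed.

Lemma near_weaken n x y d d' : near n x y d -> d <= d' -> near n x y d'.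
Proof. intros H Hd i Hi. specialize (H i Hi). lra. Qed.

(** * Continuous functions on a compact set *)

Section SpatialFunctions.

Context {n : nat} {Om : pt -> Prop}.

Lemma contOn_const (c : R) : contOn n Om (fun _ => c).
Proof.
  intros x _ eps He. exists 1; split; [lra|]. intros.
  rewrite Rminus_diag, Rabs_R0; exact He.
Qed.

Lemma contOn_uniform_limit (u : pt -> R) :
  (forall eps, eps > 0 -> exists v, contOn n Om v /\ suple Om (fun x => u x - v x) eps) ->
  contOn n Om u.
Proof.
  intros H x Hx eps He.
  destruct (H (eps / 4)) as [v [Hv Huv]]; [lra|].
  destruct (Hv x Hx (eps / 2)) as [d [Hd Hd']]; [lra|].
  exists d; split; [exact Hd|]. intros y Hy Hn.
  specialize (Hd' y Hy Hn). pose proof (Huv x Hx) as H1. pose proof (Huv y Hy) as H2.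
  simpl in H1, H2. rewrite (Rabs_minus_sym (u x) (v x)) in H1.
  apply Rabs_def2 in Hd'. apply Rabs_le_between in H1. apply Rabs_le_between in H2.
  apply Rabs_def1; lra.
Qed.

Lemma contOn_ext (u v : pt -> R) :
  (forall x, Om x -> u x = v x) -> contOn n Om u -> contOn n Om v.
Proof.
  intros H Hu x Hx eps He. destruct (Hu x Hx eps He) as [d [Hd Hd']].
  exists d; split; [exact Hd|]. intros y Hy Hn. rewrite <- !H by assumption. auto.
Qed.

Lemma contOn_plus (u v : pt -> R) :
  contOn n Om u -> contOn n Om v -> contOn n Om (fun x => u x + v x).
Proof.
  intros Hu Hv x Hx eps He.
  destruct (Hu x Hx (eps / 2)) as [d1 [Hd1 H1]]; [lra|].
  destruct (Hv x Hx (eps / 2)) as [d2 [Hd2 H2]]; [lra|].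
  exists (Rmin d1 d2); split; [apply Rmin_glb_lt; assumption|].
  intros y Hy Hn.
  specialize (H1 y Hy (near_weaken _ _ _ _ _ Hn (Rmin_l _ _))).
  specialize (H2 y Hy (near_weaken _ _ _ _ _ Hn (Rmin_r _ _))).
  replace (u y + v y - (u x + v x)) with ((u y - u x) + (v y - v x)) by ring.
  eapply Rle_lt_trans; [apply Rabs_triang|lra].
Qed.

Lemma contOn_scal (c : R) (u : pt -> R) :
  contOn n Om u -> contOn n Om (fun x => c * u x).
Proof.
  intros Hu x Hx eps He.
  destruct (Hu x Hx (eps / (Rabs c + 1))) as [d [Hd H]].
  { apply Rdiv_lt_0_compat; [exact He|]. pose proof (Rabs_pos c); lra. }
  exists d; split; [exact Hd|]. intros y Hy Hn. specialize (H y Hy Hn).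
  rewrite <- Rmult_minus_distr_l, Rabs_mult.
  pose proof (Rabs_pos c). pose proof (Rabs_pos (u y - u x)).
  apply Rle_lt_trans with ((Rabs c + 1) * Rabs (u y - u x)); [nra|].
  apply Rmult_lt_reg_l with (/ (Rabs c + 1)); [apply Rinv_0_lt_compat; lra|].
  rewrite <- Rmult_assoc, Rinv_l, Rmult_1_l by lra. unfold Rdiv in H; lra.
Qed.

Lemma contOn_minus (u v : pt -> R) :
  contOn n Om u -> contOn n Om v -> contOn n Om (fun x => u x - v x).
Proof.
  intros Hu Hv. apply contOn_ext with (fun x => u x + (-1) * v x); [intros; ring|].
  apply contOn_plus; [|apply contOn_scal]; assumption.
Qed.

Lemma contOn_bounded (u : pt -> R) :
  Omega_hyp n Om -> contOn n Om u -> exists M, 0 <= M /\ suple Om u M.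
Proof.
  intros [_ Hc] Hu. apply NNPP; intros Hn.
  assert (H : forall k : nat, exists x, Om x /\ INR k < Rabs (u x)).
  { intros k. apply NNPP; intros Hk. apply Hn. exists (INR k); split; [apply pos_INR|].
    intros x Hx. apply Rnot_lt_le; intros Hlt. apply Hk; exists x; auto. }
  destruct (choice _ H) as [s Hs].
  destruct (Hc s (fun k => proj1 (Hs k))) as [phi [l [Hphi [Hl Hlim]]]].
  destruct (Hu l Hl 1) as [d [Hd Hd']]; [lra|].
  destruct (Hlim d Hd) as [N HN].
  destruct (nfloor_ex (Rabs (u l) + 1)) as [N' [_ HN']].
  { pose proof (Rabs_pos (u l)); lra. }
  (* Beyond [S N'] the values exceed |u l| + 1, while continuity at the limit [l] keeps them within
     1 of u l. *)
  set (k := max N (S N')).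
  specialize (Hd' (s (phi k)) (proj1 (Hs _)) (HN k ltac:(lia))).
  pose proof (proj2 (Hs (phi k))) as Hk.
  assert (INR (S N') <= INR (phi k)).
  { apply le_INR. pose proof (strictly_increasing_ge phi Hphi k). lia. }
  rewrite S_INR in *.
  pose proof (Rabs_le_near _ _ _ _ (Rle_refl (Rabs (u l))) (Rlt_le _ _ Hd')). lra.
Qed.

(** The reciprocal is continuous, hence bounded by some M, and 1 / (M + 1) is then a lower bound; no
    minimiser has to be found. *)
Lemma contOn_lower_bound (u : pt -> R) :
  Omega_hyp n Om -> contOn n Om u -> (forall x, Om x -> 0 < u x) ->
  exists m, 0 < m /\ forall x, Om x -> m <= u x.
Proof.
  intros HO Hu Hpos.
  destruct (contOn_bounded (fun x => / u x) HO) as [M [HM HM']].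
  { intros x Hx eps He. pose proof (Hpos x Hx) as Hp.
    (* The first bound gives u y >= u x / 2; with it the second makes the reciprocals differ by less
       than [eps]. *)
    destruct (Hu x Hx (Rmin (u x / 2) (eps * (u x * u x) / 2))) as [d [Hd H]].
    { apply Rmin_glb_lt; [lra|]. apply Rdiv_lt_0_compat; [|lra].
      apply Rmult_lt_0_compat; [lra|nra]. }
    exists d; split; [exact Hd|]. intros y Hy Hn. specialize (H y Hy Hn).
    pose proof (Rlt_le_trans _ _ _ H (Rmin_l _ _)) as H1.
    pose proof (Rlt_le_trans _ _ _ H (Rmin_r _ _)) as H2.
    apply Rabs_def2 in H1.
    replace (/ u y - / u x) with (- (u y - u x) * / (u y * u x)) by (field; lra).
    rewrite Rabs_mult, Rabs_Ropp, Rabs_inv, (Rabs_pos_eq (u y * u x)) by nra.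
    apply Rmult_lt_reg_r with (u y * u x); [nra|].
    rewrite Rmult_assoc, Rinv_l, Rmult_1_r by nra.
    eapply Rlt_le_trans; [exact H2|].
    assert (u x * u x / 2 <= u y * u x) by nra. nra. }
  exists (/ (M + 1)). split; [apply Rinv_0_lt_compat; lra|].
  intros x Hx. pose proof (Hpos x Hx). pose proof (HM' x Hx) as H1. simpl in H1.
  rewrite Rabs_pos_eq in H1 by (left; apply Rinv_0_lt_compat; lra).
  rewrite <- (Rinv_inv (u x)). apply Rinv_le_contravar; [apply Rinv_0_lt_compat|]; lra.
Qed.

(** * Time-dependent families of continuous functions *)

Lemma contC_sub (I J : R -> Prop) (phi : R -> pt -> R) :
  (forall t, J t -> I t) -> contC n Om I phi -> contC n Om J phi.
Proof.
  intros HJ [H1 H2]. split; [auto|]. intros t Ht eps He.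
  destruct (H2 t (HJ t Ht) eps He) as [d [Hd H]]. exists d; split; auto.
Qed.

Lemma contC_ext (I : R -> Prop) (phi psi : R -> pt -> R) :
  (forall t x, I t -> Om x -> phi t x = psi t x) -> contC n Om I phi -> contC n Om I psi.
Proof.
  intros H [H1 H2]. split.
  - intros t Ht. apply contOn_ext with (phi t); auto.
  - intros t Ht eps He. destruct (H2 t Ht eps He) as [d [Hd H']].
    exists d; split; [exact Hd|]. intros s Hs Hst x Hx.
    rewrite <- !H by assumption. exact (H' s Hs Hst x Hx).
Qed.

Lemma contC_plus (I : R -> Prop) (phi psi : R -> pt -> R) :
  contC n Om I phi -> contC n Om I psi -> contC n Om I (fun t x => phi t x + psi t x).
Proof.
  intros [H1 H2] [H3 H4]. split; [intros t Ht; apply contOn_plus; auto|].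
  intros t Ht eps He.
  destruct (H2 t Ht (eps / 2)) as [d1 [Hd1 K1]]; [lra|].
  destruct (H4 t Ht (eps / 2)) as [d2 [Hd2 K2]]; [lra|].
  exists (Rmin d1 d2); split; [apply Rmin_glb_lt; assumption|].
  intros s Hs Hst x Hx.
  specialize (K1 s Hs (Rlt_le_trans _ _ _ Hst (Rmin_l _ _)) x Hx).
  specialize (K2 s Hs (Rlt_le_trans _ _ _ Hst (Rmin_r _ _)) x Hx).
  simpl in *.
  replace (phi s x + psi s x - (phi t x + psi t x))
    with ((phi s x - phi t x) + (psi s x - psi t x)) by ring.
  eapply Rle_trans; [apply Rabs_triang|lra].
Qed.

Lemma contC_scal (I : R -> Prop) (g : R -> R) (phi : R -> pt -> R) :
  Omega_hyp n Om -> (forall t, I t -> continuous g t) ->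
  contC n Om I phi -> contC n Om I (fun t x => g t * phi t x).
Proof.
  intros HO Hg [H1 H2]. split; [intros t Ht; apply contOn_scal; auto|].
  intros t Ht eps He.
  destruct (contOn_bounded (phi t) HO (H1 t Ht)) as [M [HM HM']].
  set (e1 := eps / (2 * (Rabs (g t) + 1))).
  assert (He1 : 0 < e1).
  { pose proof (Rabs_pos (g t)). apply Rdiv_lt_0_compat; lra. }
  set (e2 := Rmin 1 (eps / (2 * (M + 1)))).
  assert (He2 : 0 < e2).
  { apply Rmin_glb_lt; [lra|]. apply Rdiv_lt_0_compat; lra. }
  destruct (H2 t Ht e1) as [d1 [Hd1 K1]]; [lra|].
  destruct (proj1 (filterlim_locally g (g t)) (Hg t Ht) (mkposreal e2 He2)) as [d2 K2].
  exists (Rmin d1 d2); split; [apply Rmin_glb_lt; [assumption|apply cond_pos]|].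
  intros s Hs Hst x Hx.
  specialize (K1 s Hs (Rlt_le_trans _ _ _ Hst (Rmin_l _ _)) x Hx).
  specialize (K2 s (Rlt_le_trans _ _ _ Hst (Rmin_r _ _))).
  change (Rabs (g s - g t) < e2) in K2. simpl in K1.
  specialize (HM' x Hx).
  replace (g s * phi s x - g t * phi t x)
    with (g s * (phi s x - phi t x) + (g s - g t) * phi t x) by ring.
  assert (Hgs : Rabs (g s) <= Rabs (g t) + 1).
  { apply Rabs_le_near with (g t); [lra|]. pose proof (Rmin_l 1 (eps / (2 * (M + 1)))).
    fold e2 in H. lra. }
  eapply Rle_trans; [apply Rabs_triang|].
  pose proof (Rabs_mult_le _ _ _ _ Hgs K1) as E1.
  pose proof (Rabs_mult_le _ _ _ _ (Rlt_le _ _ K2) HM') as E2.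
  assert ((Rabs (g t) + 1) * e1 = eps / 2).
  { unfold e1; field. pose proof (Rabs_pos (g t)); lra. }
  assert (e2 * M <= eps / 2).
  { apply Rle_trans with (eps / (2 * (M + 1)) * (M + 1)).
    - apply Rmult_le_compat; [lra|lra|apply Rmin_r|lra].
    - right; field; lra. }
  lra.
Qed.

Lemma contC_minus (I : R -> Prop) (phi psi : R -> pt -> R) :
  Omega_hyp n Om -> contC n Om I phi -> contC n Om I psi ->
  contC n Om I (fun t x => phi t x - psi t x).
Proof.
  intros HO H1 H2. apply contC_ext with (fun t x => phi t x + -1 * psi t x); [intros; ring|].
  apply contC_plus; [exact H1|].
  apply (contC_scal I (fun _ => -1)); [exact HO|intros; apply continuous_const|exact H2].
Qed.

(** The local bound M is stored in the radius through M <= 1 / d, so the uniform lower bound on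
    radii supplied by [compact_unif] becomes a global upper bound. *)
Lemma contC_bounded (I : R -> Prop) (phi : R -> pt -> R) (a b : R) :
  Omega_hyp n Om -> contC n Om I phi -> (forall t, a <= t <= b -> I t) ->
  exists M, 0 <= M /\ forall t, a <= t <= b -> suple Om (phi t) M.
Proof.
  intros HO [H1 H2] HI.
  destruct (compact_unif a b (fun s d => exists M, 0 <= M /\
     forall r, a <= r <= b -> Rabs (r - s) < d -> suple Om (phi r) M /\ M <= / d))
    as [d [Hd H]].
  { intros s Hs.
    destruct (contOn_bounded (phi s) HO (H1 s (HI s Hs))) as [M [HM HM']].
    destruct (H2 s (HI s Hs) 1) as [d [Hd Hd']]; [lra|].
    assert (Hp : 0 < / (M + 1)) by (apply Rinv_0_lt_compat; lra).
    exists (Rmin d (/ (M + 1))). split; [apply Rmin_glb_lt; assumption|].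
    exists (M + 1). split; [lra|]. intros r Hr Hrs. split.
    - intros x Hx. apply Rabs_le_near with (phi s x); [apply HM'; auto|].
      apply Hd'; auto. eapply Rlt_le_trans; [exact Hrs|apply Rmin_l].
    - rewrite <- (Rinv_inv (M + 1)) at 1. apply Rinv_le_contravar; [|apply Rmin_r].
      apply Rmin_glb_lt; assumption. }
  exists (/ d). split; [left; apply Rinv_0_lt_compat; lra|].
  intros t Ht x Hx. destruct (H t Ht) as [s [e [Hs [[M [HM HP]] [Hts Hde]]]]].
  destruct (HP t Ht Hts) as [H3 H4]. eapply Rle_trans; [apply H3; exact Hx|].
  eapply Rle_trans; [exact H4|]. apply Rinv_le_contravar; lra.
Qed.

Lemma contC_unif_cont (I : R -> Prop) (phi : R -> pt -> R) (a b : R) :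
  contC n Om I phi -> (forall t, a <= t <= b -> I t) ->
  forall eps, eps > 0 -> exists d, d > 0 /\ forall s t, a <= s <= b -> a <= t <= b ->
    Rabs (s - t) < d -> suple Om (fun x => phi s x - phi t x) eps.
Proof.
  intros [_ H2] HI eps He.
  (* The window is twice the radius, so that a point within [d] of [t] still lies in the window of
     the centre chosen for [t]. *)
  destruct (compact_unif a b (fun s d => forall r, a <= r <= b -> Rabs (r - s) < 2 * d ->
     suple Om (fun x => phi r x - phi s x) (eps / 2))) as [d [Hd H]].
  { intros s Hs. destruct (H2 s (HI s Hs) (eps / 2)) as [d [Hd Hd']]; [lra|].
    exists (d / 2). split; [lra|]. intros r Hr Hrs. apply Hd'; auto. lra. }
  exists d; split; [exact Hd|]. intros s t Hs Ht Hst x Hx.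
  destruct (H t Ht) as [r [e [Hr [HP [Htr Hde]]]]].
  pose proof (HP t Ht ltac:(lra) x Hx) as E1.
  pose proof (Rabs_lt_sub _ _ _ _ _ Hst Htr) as Hsr.
  pose proof (HP s Hs ltac:(lra) x Hx) as E2. simpl in E1, E2.
  rewrite Rabs_minus_sym in E1. replace eps with (eps / 2 + eps / 2) by lra.
  eapply Rabs_le_sub; eassumption.
Qed.

(** Spatial continuity that is uniform over a compact time interval passes under a time integral. *)
Lemma contC_equicont (I : R -> Prop) (phi : R -> pt -> R) (a b : R) :
  contC n Om I phi -> (forall t, a <= t <= b -> I t) ->
  forall x eps, Om x -> eps > 0 -> exists d, d > 0 /\ forall y t, Om y -> near n y x d ->
    a <= t <= b -> Rabs (phi t y - phi t x) <= eps.
Proof.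
  intros [H1 H2] HI x eps Hx He.
  destruct (compact_unif a b (fun s d =>
    (forall r, a <= r <= b -> Rabs (r - s) < d ->
      suple Om (fun x => phi r x - phi s x) (eps / 3)) /\
    (forall y, Om y -> near n y x d -> Rabs (phi s y - phi s x) < eps / 3)))
    as [d [Hd H]].
  { intros s Hs. destruct (H2 s (HI s Hs) (eps / 3)) as [d1 [Hd1 K1]]; [lra|].
    destruct (H1 s (HI s Hs) x Hx (eps / 3)) as [d2 [Hd2 K2]]; [lra|].
    exists (Rmin d1 d2). split; [apply Rmin_glb_lt; assumption|]. split.
    - intros r Hr Hrs. apply K1; auto. eapply Rlt_le_trans; [exact Hrs|apply Rmin_l].
    - intros y Hy Hn. apply K2; auto. eapply near_weaken; [exact Hn|apply Rmin_r]. }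
  exists d; split; [exact Hd|]. intros y t Hy Hn Ht.
  destruct (H t Ht) as [s [e [Hs [[HP1 HP2] [Hts Hde]]]]].
  pose proof (HP1 t Ht Hts x Hx) as E1. pose proof (HP1 t Ht Hts y Hy) as E2.
  pose proof (HP2 y Hy (near_weaken _ _ _ _ _ Hn Hde)) as E3. simpl in E1, E2.
  apply Rabs_le_between in E1. apply Rabs_le_between in E2. apply Rabs_def2 in E3.
  apply Rabs_le_between; lra.
Qed.

Lemma contC_continuous (I : R -> Prop) (phi : R -> pt -> R) (x : pt) (t : R) :
  contC n Om I phi -> Om x -> I t -> locally t I -> continuous (fun s => phi s x) t.
Proof.
  intros [_ H] Hx Ht [d1 HI]. apply filterlim_locally. intros eps.
  destruct (H t Ht (eps / 2)) as [d2 [Hd2 H2]]; [pose proof (cond_pos eps); lra|].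
  assert (Hd : 0 < Rmin d1 d2) by (apply Rmin_glb_lt; [apply cond_pos|exact Hd2]).
  exists (mkposreal _ Hd). intros s Hs. change (Rabs (s - t) < Rmin d1 d2) in Hs.
  change (Rabs (phi s x - phi t x) < eps).
  eapply Rle_lt_trans; [|apply (Rlt_eps2_eps eps (cond_pos eps))].
  apply H2; auto.
  - apply HI. eapply Rlt_le_trans; [exact Hs|apply Rmin_l].
  - eapply Rlt_le_trans; [exact Hs|apply Rmin_r].
Qed.

(** * Derivatives in time, uniform in space *)

Lemma hasDeriv_sub (I J : R -> Prop) (phi dphi : R -> pt -> R) :
  (forall t, J t -> I t) -> hasDeriv Om I phi dphi -> hasDeriv Om J phi dphi.
Proof.
  intros HJ H t Ht eps He. destruct (H t (HJ t Ht) eps He) as [d [Hd K]].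
  exists d; split; auto.
Qed.

(** Sup-norm continuity of [g] makes its mean over [t, t + h] close to [g t] uniformly in space.
    Convexity of [I] keeps the integration variable inside [I], and one-sided derivatives at its end
    points are included. *)
Lemma hasDeriv_of_integral (I : R -> Prop) (phi g : R -> pt -> R) :
  (forall s r t, I s -> I t -> Rmin s t <= r <= Rmax s t -> I r) ->
  (forall s t x, I s -> I t -> Om x -> is_RInt (fun r => g r x) s t (phi t x - phi s x)) ->
  contC n Om I g -> hasDeriv Om I phi g.
Proof.
  intros Hconv Hint [_ Hg] t Ht eps He.
  destruct (Hg t Ht eps He) as [d [Hd K]].
  exists d; split; [exact Hd|]. intros h Hh Hhd Hth x Hx. simpl.
  pose proof (Hint t (t + h) x Ht Hth Hx) as HI.
  apply (RInt_dist_const _ _ _ _ (g t x) eps) in HI.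
  - replace (t + h - t) with h in HI by ring.
    replace ((phi (t + h) x - phi t x) / h - g t x)
      with ((phi (t + h) x - phi t x - g t x * h) / h) by (field; exact Hh).
    unfold Rdiv. rewrite Rabs_mult, Rabs_inv.
    pose proof (Rabs_pos_lt h Hh).
    apply Rmult_le_reg_r with (Rabs h); [assumption|].
    rewrite Rmult_assoc, Rinv_l, Rmult_1_r by lra. exact HI.
  - intros r Hr. apply (K r (Hconv _ _ _ Ht Hth Hr)); [|exact Hx].
    apply Rle_lt_trans with (Rabs h); [|exact Hhd].
    revert Hr. unfold Rmin, Rmax, Rabs.
    destruct (Rle_dec t (t + h)), (Rcase_abs (r - t)), (Rcase_abs h); lra.
Qed.

Lemma hasDeriv_is_derive (I : R -> Prop) (phi dphi : R -> pt -> R) (x : pt) (t : R) :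
  hasDeriv Om I phi dphi -> Om x -> I t -> locally t I ->
  is_derive (fun s => phi s x) t (dphi t x).
Proof.
  intros H Hx Ht [d1 HI]. apply is_derive_Reals. intros eps He.
  destruct (H t Ht (eps / 2)) as [d2 [Hd2 K]]; [lra|].
  assert (Hd : 0 < Rmin d1 d2) by (apply Rmin_glb_lt; [apply cond_pos|exact Hd2]).
  exists (mkposreal _ Hd). simpl. intros h Hh Hhd.
  apply Rle_lt_trans with (eps / 2); [|lra]. apply K; auto.
  - eapply Rlt_le_trans; [exact Hhd|apply Rmin_r].
  - apply HI. change (Rabs (t + h - t) < d1). replace (t + h - t) with h by ring.
    eapply Rlt_le_trans; [exact Hhd|apply Rmin_l].
Qed.

(** Needed because [dD_lt] quantifies over all derivatives of the two histories. *)
Lemma hasDeriv_unique (phi dphi dphi' : R -> pt -> R) (t : R) (x : pt) :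
  hasDeriv Om Ineg phi dphi -> hasDeriv Om Ineg phi dphi' -> t <= 0 -> Om x ->
  dphi t x = dphi' t x.
Proof.
  intros H H' Ht Hx. apply cond_eq. intros eps He.
  destruct (H t Ht (eps / 3)) as [d [Hd K]]; [lra|].
  destruct (H' t Ht (eps / 3)) as [d' [Hd' K']]; [lra|].
  (* A backward increment stays in the half line even at t = 0. *)
  set (h := - (Rmin d d' / 2)).
  assert (Hm : 0 < Rmin d d') by (apply Rmin_glb_lt; assumption).
  pose proof (Rmin_l d d'). pose proof (Rmin_r d d').
  assert (Hh : Rabs h = Rmin d d' / 2) by (unfold h; rewrite Rabs_Ropp, Rabs_pos_eq; lra).
  assert (Hn : h <> 0) by (unfold h; lra).
  assert (Hneg : Ineg (t + h)) by (unfold Ineg, h; lra).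
  specialize (K h Hn ltac:(lra) Hneg x Hx). specialize (K' h Hn ltac:(lra) Hneg x Hx).
  simpl in K, K'. rewrite Rabs_minus_sym in K.
  pose proof (Rabs_le_sub _ _ _ _ _ K K'). lra.
Qed.

(** * Bounded uniformly continuous families *)

Lemma BUCfun_ext (phi psi : R -> pt -> R) :
  (forall t x, t <= 0 -> Om x -> phi t x = psi t x) -> BUCfun n Om phi -> BUCfun n Om psi.
Proof.
  intros H [H1 [[M HM] H3]]. split; [|split].
  - intros t Ht. apply contOn_ext with (phi t); auto.
  - exists M. intros t Ht x Hx. rewrite <- H by assumption. apply HM; auto.
  - intros eps He. destruct (H3 eps He) as [d [Hd K]]. exists d; split; [exact Hd|].
    intros s t Hs Ht Hst x Hx. rewrite <- !H by assumption. exact (K s t Hs Ht Hst x Hx).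
Qed.

Lemma BUCfun_plus (phi psi : R -> pt -> R) :
  BUCfun n Om phi -> BUCfun n Om psi -> BUCfun n Om (fun t x => phi t x + psi t x).
Proof.
  intros [H1 [[M HM] H3]] [H1' [[M' HM'] H3']]. split; [|split].
  - intros t Ht. apply contOn_plus; auto.
  - exists (M + M'). intros t Ht x Hx. eapply Rle_trans; [apply Rabs_triang|].
    specialize (HM t Ht x Hx). specialize (HM' t Ht x Hx). lra.
  - intros eps He. destruct (H3 (eps / 2)) as [d [Hd K]]; [lra|].
    destruct (H3' (eps / 2)) as [d' [Hd' K']]; [lra|].
    exists (Rmin d d'); split; [apply Rmin_glb_lt; assumption|].
    intros s t Hs Ht Hst x Hx.
    specialize (K s t Hs Ht (Rlt_le_trans _ _ _ Hst (Rmin_l _ _)) x Hx).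
    specialize (K' s t Hs Ht (Rlt_le_trans _ _ _ Hst (Rmin_r _ _)) x Hx). simpl in *.
    replace (phi s x + psi s x - (phi t x + psi t x))
      with ((phi s x - phi t x) + (psi s x - psi t x)) by ring.
    eapply Rle_trans; [apply Rabs_triang|lra].
Qed.

Lemma BUCfun_scal (c : R) (phi : R -> pt -> R) :
  BUCfun n Om phi -> BUCfun n Om (fun t x => c * phi t x).
Proof.
  intros [H1 [[M HM] H3]]. pose proof (Rabs_pos c). split; [|split].
  - intros t Ht. apply contOn_scal; auto.
  - exists (Rabs c * M). intros t Ht x Hx. apply Rabs_mult_le; [lra|apply HM; auto].
  - intros eps He. destruct (H3 (eps / (Rabs c + 1))) as [d [Hd K]].
    { apply Rdiv_lt_0_compat; lra. }
    exists d; split; [exact Hd|]. intros s t Hs Ht Hst x Hx.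
    specialize (K s t Hs Ht Hst x Hx). simpl in *.
    rewrite <- Rmult_minus_distr_l, Rabs_mult.
    pose proof (Rabs_pos (phi s x - phi t x)).
    apply Rle_trans with ((Rabs c + 1) * Rabs (phi s x - phi t x)); [nra|].
    apply Rle_trans with ((Rabs c + 1) * (eps / (Rabs c + 1))).
    + apply Rmult_le_compat_l; lra.
    + right; field; lra.
Qed.

Lemma BUCfun_contC (phi : R -> pt -> R) : BUCfun n Om phi -> contC n Om Ineg phi.
Proof.
  intros [H1 [_ H3]]. split; [exact H1|]. intros t Ht eps He.
  destruct (H3 eps He) as [d [Hd K]]. exists d; split; [exact Hd|].
  intros s Hs Hst. apply K; auto.
Qed.

(** Only the behaviour at minus infinity matters, since continuity on the compact remainder [a, 0]
    is automatically bounded and uniform. *)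
Lemma BUCfun_of_tail (phi : R -> pt -> R) (a : R) :
  Omega_hyp n Om -> contC n Om Ineg phi -> BUCfun n Om (fun t => phi (a + t)) ->
  BUCfun n Om phi.
Proof.
  intros HO Hc [_ [[M HM] H3]]. split; [apply Hc|split].
  - destruct (contC_bounded Ineg phi a 0 HO Hc) as [M' [_ HM']].
    { intros t Ht; unfold Ineg; lra. }
    exists (Rmax M M'). intros t Ht x Hx. destruct (Rle_lt_dec t a) as [Hta|Hta].
    + eapply Rle_trans; [|apply Rmax_l]. replace t with (a + (t - a)) by ring.
      apply (HM (t - a)); [lra|exact Hx].
    + eapply Rle_trans; [|apply Rmax_r]. apply HM'; [lra|exact Hx].
  - intros eps He. destruct (H3 eps He) as [d [Hd K]].
    (* The compact piece overlaps the tail by 1 and the final modulus is at most 1, so two close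
       times always share a piece. *)
    destruct (contC_unif_cont Ineg phi (a - 1) 0 Hc) with (eps := eps) as [d' [Hd' K']].
    { intros t Ht; unfold Ineg; lra. }
    { exact He. }
    exists (Rmin 1 (Rmin d d')). split; [repeat apply Rmin_glb_lt; lra|].
    intros s t Hs Ht Hst.
    pose proof (Rlt_le_trans _ _ _ Hst (Rmin_l _ _)) as E1.
    pose proof (Rlt_le_trans _ _ _ Hst (Rmin_r _ _)) as E2.
    pose proof (Rlt_le_trans _ _ _ E2 (Rmin_l _ _)) as E3.
    pose proof (Rlt_le_trans _ _ _ E2 (Rmin_r _ _)) as E4.
    destruct (Rle_lt_dec s a) as [Hsa|Hsa]; [destruct (Rle_lt_dec t a) as [Hta|Hta]|].
    + replace s with (a + (s - a)) by ring. replace t with (a + (t - a)) by ring.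
      apply K; [lra|lra|]. replace (s - a - (t - a)) with (s - t) by ring. exact E3.
    + apply Rabs_def2 in E1. apply K'; [lra|lra|exact E4].
    + apply Rabs_def2 in E1. apply K'; [lra|lra|exact E4].
Qed.

End SpatialFunctions.

(** * Maximal times and stability of the delay equation *)

Lemma Tlt_le_trans (s t : R) (T : option R) : s <= t -> Tlt t T -> Tlt s T.
Proof. destruct T; simpl; intros; lra. Qed.

Lemma Tlt_between (t : R) (T : option R) : Tlt t T -> exists t1, t < t1 /\ Tlt t1 T.
Proof.
  destruct T as [T0|]; simpl; intros H; [exists ((t + T0) / 2)|exists (t + 1)]; split; lra.
Qed.

Lemma Tlt_locally (t : R) (T : option R) : Tlt t T -> locally t (fun s => Tlt s T).
Proof.
  intros H. destruct (Tlt_between t T H) as [t1 [Ht1 HT]].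
  assert (Hd : 0 < t1 - t) by lra. exists (mkposreal _ Hd). intros s Hs.
  change (Rabs (s - t) < t1 - t) in Hs. apply Rabs_def2 in Hs.
  apply Tlt_le_trans with t1; [lra|exact HT].
Qed.

(** Stability of the solution [tau] of [int_(l-tau)^l g = I] under perturbations of [g] and
    [I].  Smallness of the data keeps [tau'] within distance 1 of [tau], so that the lower bound
    [m] is only needed on an interval known in advance. *)
Lemma delay_stability (g g' : R -> R) (l tau tau' I I' e1 e2 m : R) :
  (forall a, a <= l -> ex_RInt g' a l) ->
  is_RInt g (l - tau) l I -> is_RInt g' (l - tau') l I' -> Rabs (I - I') <= e1 ->
  0 <= tau -> 0 <= tau' -> 0 < m ->
  (forall r, l - tau <= r <= l -> Rabs (g r - g' r) <= e2) ->
  (forall r, r <= l -> 0 <= g' r) ->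
  (forall r, l - tau - 1 <= r <= l -> m <= g' r) ->
  e1 + e2 * tau < m -> Rabs (tau' - tau) <= (e1 + e2 * tau) / m.
Proof.
  intros Hex HI HI' HII Ht Ht' Hm Hgg Hpos Hlow Hsmall.
  assert (from_l : forall a, a <= l -> exists J, is_RInt g' l a J).
  { intros a Ha. destruct (Hex a Ha) as [J HJ]. eexists. apply is_RInt_swap. exact HJ. }
  assert (low : forall a b J, l - tau - 1 <= a -> a <= b -> b <= l ->
            is_RInt g' a b J -> m * (b - a) <= J).
  { intros a b J Ha Hab Hb HJ.
    pose proof (is_RInt_const a b m) as Hc.
    pose proof (is_RInt_le _ _ _ _ _ _ Hab Hc HJ ltac:(intros; apply Hlow; lra)) as H.
    unfold scal in H; simpl in H; unfold mult in H; simpl in H. lra. }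
  (* [J] integrates the perturbed [g'] over the unperturbed window: it differs from [I] only by the
     integrand and from [I'] only by the window. *)
  destruct (Hex (l - tau) ltac:(lra)) as [J HJ].
  assert (HJI : Rabs (I - J) <= e2 * tau).
  { pose proof (is_RInt_minus _ _ _ _ _ _ HI HJ) as HD.
    apply (RInt_bound _ _ _ _ e2) in HD.
    - replace (l - (l - tau)) with tau in HD by ring.
      rewrite (Rabs_pos_eq tau) in HD by lra. exact HD.
    - intros r Hr. rewrite Rmin_left, Rmax_right in Hr by lra. apply Hgg; exact Hr. }
  assert (Hd : Rabs (J - I') <= e1 + e2 * tau).
  { rewrite Rabs_minus_sym in HJI. rewrite (Rplus_comm e1).
    eapply Rabs_le_sub; eassumption. }
  apply Rabs_le_between in Hd.
  pose proof (is_RInt_swap _ _ _ _ HJ) as HJs.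
  pose proof (is_RInt_swap _ _ _ _ HI') as HIs.
  change (is_RInt g' l (l - tau) (- J)) in HJs.
  change (is_RInt g' l (l - tau') (- I')) in HIs.
  apply Rmult_le_reg_l with m; [exact Hm|].
  replace (m * ((e1 + e2 * tau) / m)) with (e1 + e2 * tau) by (field; lra).
  destruct (Rle_lt_dec tau' tau) as [Hle|Hlt].
  - pose proof (is_RInt_sub _ _ _ _ _ _ HJs HIs) as HK.
    apply low in HK; try lra.
    rewrite Rabs_left1 by lra. lra.
  (* Truncating at tau + 1 stays where the bound [m] holds. The estimate then yields tau'' < tau +
     1, so nothing was truncated. *)
  - set (tau'' := Rmin tau' (tau + 1)).
    assert (H3 : tau < tau'' /\ tau'' <= tau' /\ tau'' <= tau + 1).
    { unfold tau'', Rmin; destruct (Rle_dec tau' (tau + 1)); lra. }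
    destruct (from_l (l - tau'') ltac:(lra)) as [J'' HJ''].
    pose proof (is_RInt_sub _ _ _ _ _ _ HJ'' HJs) as HK.
    apply low in HK; try lra.
    pose proof (is_RInt_sub _ _ _ _ _ _ HIs HJ'') as HK'.
    (* Beyond the truncation only [g'] >= 0 is known, which suffices to drop that part of the
       integral. *)
    assert (0 <= J'' - - I').
    { pose proof (is_RInt_const (l - tau') (l - tau'') 0) as Hc.
      refine (Rle_trans _ _ _ _ (is_RInt_le _ _ _ _ _ _ _ Hc HK' _)); [|lra|].
      - unfold scal; simpl; unfold mult; simpl; lra.
      - intros r Hr; apply Hpos; lra. }
    assert (H4 : m * (tau'' - tau) <= e1 + e2 * tau) by lra.
    assert (H5 : tau'' < tau + 1) by nra.
    assert (H6 : tau'' = tau').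
    { unfold tau'', Rmin in *; destruct (Rle_dec tau' (tau + 1)); lra. }
    rewrite H6 in H4. rewrite Rabs_pos_eq by lra. exact H4.
Qed.

(** * Time shifts and the exponential weight *)

Section Semiflow.

Context {n : nat} {Om : pt -> Prop} (HO : Omega_hyp n Om).

Lemma contC_shift (I : R -> Prop) (B : R -> pt -> R) (t : R) :
  contC n Om I B -> contC n Om (fun th => I (t + th)) (shift B t).
Proof.
  intros [H1 H2]. split; [intros th Hth; apply H1; exact Hth|].
  intros th Hth eps He. destruct (H2 (t + th) Hth eps He) as [d [Hd K]].
  exists d; split; [exact Hd|]. intros s Hs Hst. apply (K (t + s) Hs).
  replace (t + s - (t + th)) with (s - th) by ring. exact Hst.
Qed.

Lemma hasDeriv_shift (I : R -> Prop) (B dB : R -> pt -> R) (t : R) :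
  hasDeriv Om I B dB -> hasDeriv Om (fun th => I (t + th)) (shift B t) (shift dB t).
Proof.
  intros H th Hth eps He. destruct (H (t + th) Hth eps He) as [d [Hd K]].
  exists d; split; [exact Hd|]. intros h Hh Hhd HI x Hx. unfold shift. rewrite <- Rplus_assoc in *.
  apply K; auto.
Qed.

Lemma hasDeriv_ext (I : R -> Prop) (B B' dB dB' : R -> pt -> R) :
  (forall t x, I t -> Om x -> B t x = B' t x) ->
  (forall t x, I t -> Om x -> dB t x = dB' t x) ->
  hasDeriv Om I B dB -> hasDeriv Om I B' dB'.
Proof.
  intros E1 E2 H t Ht eps He. destruct (H t Ht eps He) as [d [Hd K]].
  exists d; split; [exact Hd|]. intros h Hh Hhd HI x Hx.
  rewrite <- !E1, <- E2 by assumption. exact (K h Hh Hhd HI x Hx).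
Qed.

Lemma exp_weight_continuous (alpha t : R) : continuous (fun s => exp (- alpha * Rabs s)) t.
Proof.
  apply (continuous_comp (fun s => - alpha * Rabs s) exp).
  - apply (continuous_scal_r (- alpha) Rabs), continuous_Rabs.
  - apply continuous_exp.
Qed.

Lemma exp_weight_nonpos (alpha t : R) : t <= 0 -> exp (- alpha * Rabs t) = exp (alpha * t).
Proof. intros H. rewrite Rabs_left1 by exact H. f_equal; ring. Qed.

(** Before time -t the weighted shift is exp(-alpha t) times a translate of [wt alpha B]; only the
    compact interval [-t, 0] is new. *)
Lemma BUCfun_wt_shift (alpha : R) (B : R -> pt -> R) (t : R) :
  0 <= t -> contC n Om (fun r => r <= t) B -> BUCfun n Om (wt alpha B) ->
  BUCfun n Om (wt alpha (shift B t)).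
Proof.
  intros Ht Hc HB. apply (BUCfun_of_tail _ (- t) HO).
  - unfold wt. apply contC_scal; [exact HO|intros; apply exp_weight_continuous|].
    apply contC_sub with (fun th => t + th <= t); [unfold Ineg; intros; lra|].
    apply (contC_shift (fun r => r <= t)), Hc.
  - apply BUCfun_ext with (fun th x => exp (- alpha * t) * wt alpha B th x);
      [|apply BUCfun_scal, HB].
    intros th x Hth Hx. unfold wt, shift. rewrite !exp_weight_nonpos by lra.
    rewrite <- Rmult_assoc, <- exp_plus.
    replace (t + (- t + th)) with th by ring. do 2 f_equal. ring.
Qed.

(** Conditions on the derivative of the weighted history thus reduce to conditions on the weighted
    derivative, which behaves well under shifts. *)
Lemma dwt_split (alpha : R) (phi dphi : R -> pt -> R) (t : R) (x : pt) :
  dwt alpha phi dphi t x = alpha * wt alpha phi t x + wt alpha dphi t x.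
Proof. unfold dwt, wt. ring. Qed.

Lemma BUCfun_dwt (alpha : R) (phi dphi : R -> pt -> R) :
  BUCfun n Om (wt alpha phi) -> BUCfun n Om (wt alpha dphi) -> BUCfun n Om (dwt alpha phi dphi).
Proof.
  intros H1 H2. eapply BUCfun_ext; [intros; symmetry; apply dwt_split|].
  apply (BUCfun_plus (fun t x => alpha * wt alpha phi t x)); [apply BUCfun_scal|]; assumption.
Qed.

Lemma BUCfun_wt_deriv (alpha : R) (phi dphi : R -> pt -> R) :
  BUCfun n Om (wt alpha phi) -> BUCfun n Om (dwt alpha phi dphi) -> BUCfun n Om (wt alpha dphi).
Proof.
  intros H1 H2.
  apply BUCfun_ext with (fun t x => (- alpha) * wt alpha phi t x + dwt alpha phi dphi t x).
  - intros t x _ _. rewrite dwt_split. ring.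
  - apply BUCfun_plus; [apply BUCfun_scal|]; assumption.
Qed.

(** ** Gluing the history to the forward solution *)

Definition glue (g1 g2 : R -> pt -> R) : R -> pt -> R :=
  fun t => if Rle_dec t 0 then g1 t else g2 t.

Lemma glue_neg (g1 g2 : R -> pt -> R) (t : R) : t <= 0 -> glue g1 g2 t = g1 t.
Proof. intros H. unfold glue. destruct (Rle_dec t 0); [reflexivity|lra]. Qed.

Lemma glue_nonneg (g1 g2 : R -> pt -> R) (t : R) (x : pt) :
  g1 0 x = g2 0 x -> 0 <= t -> glue g1 g2 t x = g2 t x.
Proof.
  intros E H. unfold glue. destruct (Rle_dec t 0); [|reflexivity].
  replace t with 0 by lra. exact E.
Qed.

Lemma contC_glue (g1 g2 : R -> pt -> R) (T : option R) :
  contC n Om Ineg g1 -> contC n Om (fun t => 0 <= t /\ Tlt t T) g2 ->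
  (forall x, Om x -> g1 0 x = g2 0 x) -> contC n Om (fun t => Tlt t T) (glue g1 g2).
Proof.
  intros H1 H2 E.
  assert (C1 : contC n Om Ineg (glue g1 g2)).
  { apply contC_ext with g1; [|exact H1]. intros; rewrite glue_neg; auto. }
  assert (C2 : contC n Om (fun t => 0 <= t /\ Tlt t T) (glue g1 g2)).
  { apply contC_ext with g2; [|exact H2]. intros t x [Ht _] Hx. rewrite glue_nonneg; auto. }
  clear H1 H2. destruct C1 as [H1 K1], C2 as [H2 K2]. split.
  - intros t Ht. destruct (Rle_lt_dec t 0); [apply H1; exact r|apply H2; split; [lra|exact Ht]].
  - intros t Ht eps He.
    assert (exists d1, d1 > 0 /\ forall s, s <= 0 -> Rabs (s - t) < d1 ->
              suple Om (fun x => glue g1 g2 s x - glue g1 g2 t x) eps) as [d1 [Hd1 Q1]].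
    { destruct (Rle_lt_dec t 0) as [H|H].
      - apply (K1 t H eps He).
      (* For t > 0 the radius [t] excludes all s <= 0, so the claim is vacuous. *)
      - exists t; split; [exact H|]. intros s Hs Hst. apply Rabs_def2 in Hst; lra. }
    assert (exists d2, d2 > 0 /\ forall s, 0 <= s -> Tlt s T -> Rabs (s - t) < d2 ->
              suple Om (fun x => glue g1 g2 s x - glue g1 g2 t x) eps) as [d2 [Hd2 Q2]].
    { destruct (Rle_lt_dec 0 t) as [H|H].
      - destruct (K2 t (conj H Ht) eps He) as [d [Hd Q]].
        exists d; split; [exact Hd|]. intros s Hs HsT. apply Q; auto.
      - exists (- t); split; [lra|]. intros s Hs _ Hst. apply Rabs_def2 in Hst; lra. }
    exists (Rmin d1 d2); split; [apply Rmin_glb_lt; assumption|]. intros s Hs Hst.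
    destruct (Rle_lt_dec s 0).
    + apply Q1; [assumption|]. eapply Rlt_le_trans; [exact Hst|apply Rmin_l].
    + apply Q2; [lra|assumption|]. eapply Rlt_le_trans; [exact Hst|apply Rmin_r].
Qed.

Lemma hasDeriv_glue (A g1 g2 : R -> pt -> R) (T : option R) :
  hasDeriv Om Ineg A g1 -> hasDeriv Om (fun t => 0 <= t /\ Tlt t T) A g2 ->
  (forall x, Om x -> g1 0 x = g2 0 x) -> hasDeriv Om (fun t => Tlt t T) A (glue g1 g2).
Proof.
  intros H1 H2 E t Ht eps He.
  assert (exists d1, d1 > 0 /\ forall h, h <> 0 -> Rabs h < d1 -> t + h <= 0 ->
    suple Om (fun x => (A (t + h) x - A t x) / h - glue g1 g2 t x) eps) as [d1 [Hd1 Q1]].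
  { destruct (Rle_lt_dec t 0) as [H|H].
    - destruct (H1 t H eps He) as [d [Hd Q]]. exists d; split; [exact Hd|].
      rewrite glue_neg by exact H. exact Q.
    - exists t; split; [exact H|]. intros h _ Hh Hth. apply Rabs_def2 in Hh; lra. }
  assert (exists d2, d2 > 0 /\ forall h, h <> 0 -> Rabs h < d2 -> 0 <= t + h -> Tlt (t + h) T ->
    suple Om (fun x => (A (t + h) x - A t x) / h - glue g1 g2 t x) eps) as [d2 [Hd2 Q2]].
  { destruct (Rle_lt_dec 0 t) as [H|H].
    - destruct (H2 t (conj H Ht) eps He) as [d [Hd Q]]. exists d; split; [exact Hd|].
      intros h Hh Hhd Hth HT x Hx. rewrite glue_nonneg by auto. apply Q; auto.
    - exists (- t); split; [lra|]. intros h _ Hh Hth. apply Rabs_def2 in Hh; lra. }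
  exists (Rmin d1 d2); split; [apply Rmin_glb_lt; assumption|]. intros h Hh Hhd HT.
  destruct (Rle_lt_dec (t + h) 0).
  - apply Q1; auto. eapply Rlt_le_trans; [exact Hhd|apply Rmin_l].
  - apply Q2; auto; [|lra]. eapply Rlt_le_trans; [exact Hhd|apply Rmin_r].
Qed.

(** ** The nonlinearities *)

Definition admissible (K : R) (u t : pt -> R) (w : pt -> pt -> R) : Prop :=
  contOn n Om u /\ contOn n Om t /\ contOn2 n Om w /\
  suple Om u K /\ suple Om t K /\ suple2 Om w K.

Definition args_close (e : R) (u t : pt -> R) (w : pt -> pt -> R)
  (u' t' : pt -> R) (w' : pt -> pt -> R) : Prop :=
  suple Om (fun x => u x - u' x) e /\ suple Om (fun x => t x - t' x) e /\
  suple2 Om (fun x y => w x y - w' x y) e.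

Lemma F_lipschitz (F : Ftype) : F_hyp n Om F -> forall K, exists L, 0 < L /\
  forall u t w u' t' w' e, admissible K u t w -> admissible K u' t' w' -> 0 <= e ->
    args_close e u t w u' t' w' -> suple Om (fun x => F u t w x - F u' t' w' x) (L * e).
Proof.
  (* The factor 3 merges the three errors into one; the constant of [F_hyp] carries no sign, hence
     the absolute value and the 1. *)
  intros [_ HF] K. destruct (HF K) as [L HL]. exists (3 * Rabs L + 1).
  split; [pose proof (Rabs_pos L); lra|].
  intros u t w u' t' w' e (a1 & a2 & a3 & a4 & a5 & a6) (b1 & b2 & b3 & b4 & b5 & b6) He
    (c1 & c2 & c3) x Hx.
  eapply Rle_trans; [apply (HL u t w u' t' w' e e e); auto|].
  pose proof (RRle_abs L). nra.
Qed.

(** The Lipschitz bound with error 0. *)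
Lemma F_ext (F : Ftype) (K : R) u t w u' t' w' x : F_hyp n Om F ->
  admissible K u t w -> admissible K u' t' w' -> args_close 0 u t w u' t' w' -> Om x ->
  F u t w x = F u' t' w' x.
Proof.
  intros HF H1 H2 H3 Hx. destruct (F_lipschitz F HF K) as [L [_ HL]].
  pose proof (HL u t w u' t' w' 0 H1 H2 (Rle_refl 0) H3 x Hx) as H. simpl in H.
  rewrite Rmult_0_r in H. pose proof (Rabs_pos (F u t w x - F u' t' w' x)).
  apply Rminus_diag_uniq. destruct (Req_dec (F u t w x - F u' t' w' x) 0) as [|Hn]; [assumption|].
  apply Rabs_pos_lt in Hn. lra.
Qed.

Lemma f_lipschitz (f : (pt -> R) -> pt -> R) (Mf : R) : f_hyp n Om f Mf ->
  exists L, 0 < L /\ forall u v e, contOn n Om u -> contOn n Om v -> 0 <= e ->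
    suple Om (fun x => u x - v x) e -> suple Om (fun x => f u x - f v x) (L * e).
Proof.
  intros (_ & [L HL] & _). exists (Rabs L + 1). split; [pose proof (Rabs_pos L); lra|].
  intros u v e Hu Hv He H x Hx. eapply Rle_trans; [apply (HL u v e); auto|].
  pose proof (RRle_abs L). nra.
Qed.

(** Monotonicity applied in both directions. *)
Lemma f_ext (f : (pt -> R) -> pt -> R) (Mf : R) u v x : f_hyp n Om f Mf ->
  contOn n Om u -> contOn n Om v -> (forall y, Om y -> u y = v y) -> Om x -> f u x = f v x.
Proof.
  intros (_ & _ & _ & H) Hu Hv E Hx. apply Rle_antisym; apply H; auto; intros y Hy;
    rewrite (E y Hy); apply Rle_refl.
Qed.

(** By monotonicity the constant function [K] is the worst case, and its image is a single positive
    continuous function on a compact set. *)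
Lemma f_lower_bound (f : (pt -> R) -> pt -> R) (Mf K : R) : f_hyp n Om f Mf ->
  exists m, 0 < m /\ forall u x, contOn n Om u -> suple Om u K -> Om x -> m <= f u x.
Proof.
  intros (H1 & _ & H3 & H4).
  destruct (contOn_lower_bound (f (fun _ => K)) HO) as [m [Hm Hmf]].
  - apply H1, contOn_const.
  - intros x Hx. apply H3; [apply contOn_const|exact Hx].
  - exists m; split; [exact Hm|]. intros u x Hu HK Hx.
    eapply Rle_trans; [apply Hmf; exact Hx|]. apply H4; auto using contOn_const.
    intros y Hy. pose proof (HK y Hy) as H. apply Rabs_le_between in H. lra.
Qed.

Lemma f_contC (f : (pt -> R) -> pt -> R) (Mf : R) (I : R -> Prop) (A : R -> pt -> R) :
  f_hyp n Om f Mf -> contC n Om I A -> contC n Om I (fun t => f (A t)).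
Proof.
  intros Hf [H1 H2]. destruct (f_lipschitz f Mf Hf) as [L [HL Hlip]].
  split; [intros t Ht; apply Hf, H1, Ht|]. intros t Ht eps He.
  destruct (H2 t Ht (eps / L)) as [d [Hd K]]; [apply Rdiv_lt_0_compat; lra|].
  exists d; split; [exact Hd|]. intros s Hs Hst.
  replace eps with (L * (eps / L)) by (field; lra).
  apply Hlip; auto. left; apply Rdiv_lt_0_compat; lra.
Qed.

Lemma contOn2_evaluation (I : R -> Prop) (A : R -> pt -> R) (g : pt -> R) :
  contC n Om I A -> contOn n Om g -> (forall x, Om x -> I (g x)) ->
  contOn2 n Om (fun x y => A (g x) y).
Proof.
  intros [H1 H2] Hg HI x y Hx Hy eps He.
  destruct (H1 (g x) (HI x Hx) y Hy (eps / 2)) as [d1 [Hd1 K1]]; [lra|].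
  destruct (H2 (g x) (HI x Hx) (eps / 2)) as [d2 [Hd2 K2]]; [lra|].
  destruct (Hg x Hx d2 Hd2) as [d3 [Hd3 K3]].
  exists (Rmin d1 d3); split; [apply Rmin_glb_lt; assumption|].
  intros x' y' Hx' Hy' Hnx Hny.
  specialize (K1 y' Hy' (near_weaken _ _ _ _ _ Hny (Rmin_l _ _))).
  specialize (K3 x' Hx' (near_weaken _ _ _ _ _ Hnx (Rmin_r _ _))).
  specialize (K2 (g x') (HI x' Hx') K3 y' Hy'). simpl in K2.
  replace (A (g x') y' - A (g x) y)
    with ((A (g x') y' - A (g x) y') + (A (g x) y' - A (g x) y)) by ring.
  eapply Rle_lt_trans; [apply Rabs_triang|lra].
Qed.

(** ** Regularity of solutions *)

Definition rhs (F : Ftype) (A tau : R -> pt -> R) : R -> pt -> R :=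
  fun l => F (A l) (tau l) (fun y z => A (l - tau l y) z).

Context {F : Ftype} {f : (pt -> R) -> pt -> R} {Mf : R}
  (HF : F_hyp n Om F) (Hf : f_hyp n Om f Mf).
Context {phi : R -> pt -> R} {tau0 : pt -> R} {A tau : R -> pt -> R} {T : option R}
  (Hsol : is_solution n Om F f phi tau0 A tau T).

Lemma sol_history (t : R) (x : pt) : t <= 0 -> Om x -> A t x = phi t x.
Proof. apply Hsol. Qed.

Lemma sol_contC : contC n Om (fun t => Tlt t T) A.
Proof. apply Hsol. Qed.

Lemma sol_tau_contC : contC n Om (fun t => 0 <= t /\ Tlt t T) tau.
Proof. apply Hsol. Qed.

Lemma sol_tau_nonneg (t : R) (x : pt) : 0 <= t -> Tlt t T -> Om x -> 0 <= tau t x.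
Proof. apply Hsol. Qed.

Lemma sol_integral (s t : R) (x : pt) : 0 <= s -> Tlt s T -> 0 <= t -> Tlt t T -> Om x ->
  is_RInt (fun r => rhs F A tau r x) s t (A t x - A s x).
Proof.
  intros Hs HsT Ht HtT Hx. destruct Hsol as (_ & _ & _ & _ & _ & H & _).
  destruct (H s x Hs HsT Hx) as [p1 ->]. destruct (H t x Ht HtT Hx) as [p2 ->].
  replace (phi 0 x + RiemannInt p2 - (phi 0 x + RiemannInt p1))
    with (RiemannInt p2 - RiemannInt p1) by ring.
  apply is_RInt_sub with 0; apply is_RInt_of_Riemann.
Qed.

Lemma history_contOn (t : R) : t <= 0 -> contOn n Om (phi t).
Proof.
  intros Ht. apply contOn_ext with (A t); [intros; apply sol_history; auto|].
  apply sol_contC. apply Tlt_le_trans with 0; [exact Ht|apply Hsol].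
Qed.

(** The history integral is rewritten over [A] with lower limit [0 - tau0 x], so that both integrals
    have the form that [delay_stability] expects, the second one with l = 0. *)
Lemma sol_delay (t : R) (x : pt) : 0 <= t -> Tlt t T -> Om x -> 0 <= tau0 x ->
  exists I, is_RInt (fun s => f (A s) x) (t - tau t x) t I /\
            is_RInt (fun s => f (A s) x) (0 - tau0 x) 0 I.
Proof.
  intros Ht HT Hx H0. destruct Hsol as (HT0 & _ & _ & _ & _ & _ & H).
  destruct (H t x Ht HT Hx) as [p1 [p2 E]].
  exists (RiemannInt p1). split; [apply is_RInt_of_Riemann|].
  rewrite E, Rminus_0_l. eapply is_RInt_ext; [|apply is_RInt_of_Riemann].
  intros s Hs. rewrite Rmin_left, Rmax_right in Hs by lra.
  symmetry. apply (f_ext f Mf); auto.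
  - apply sol_contC. apply Tlt_le_trans with 0; [lra|exact HT0].
  - apply history_contOn; lra.
  - intros y Hy; apply sol_history; [lra|exact Hy].
Qed.

Lemma sol_f_ex_RInt (a b : R) (x : pt) : a <= b -> Tlt b T -> Om x ->
  ex_RInt (fun s => f (A s) x) a b.
Proof.
  intros Hab Hb Hx. apply (ex_RInt_continuous (fun s => f (A s) x)).
  intros z Hz. rewrite Rmin_left, Rmax_right in Hz by lra.
  assert (Tlt z T) by (apply Tlt_le_trans with b; [lra|exact Hb]).
  apply (contC_continuous (n := n) (Om := Om) (fun t => Tlt t T) (fun t => f (A t))); auto.
  - apply (f_contC f Mf); [exact Hf|exact sol_contC].
  - apply Tlt_locally; assumption.
Qed.

(** [is_solution] does not prescribe the delay at time 0. Its integral equation does, because f > 0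
    makes the length of the window unique: this is [delay_stability] with zero errors. *)
Lemma sol_tau_initial (x : pt) : (forall y, Om y -> 0 <= tau0 y) -> Om x -> tau 0 x = tau0 x.
Proof.
  intros H0 Hx. assert (HT0 : Tlt 0 T) by apply Hsol.
  destruct (sol_delay 0 x (Rle_refl 0) HT0 Hx (H0 x Hx)) as [I [I1 I2]].
  pose proof (sol_tau_nonneg 0 x (Rle_refl 0) HT0 Hx) as Hp.
  destruct (contC_bounded (fun t => Tlt t T) A (0 - tau 0 x - 1) 0 HO sol_contC) as [K [_ HK]].
  { intros t Ht. apply Tlt_le_trans with 0; [lra|exact HT0]. }
  destruct (f_lower_bound f Mf K Hf) as [m [Hm Hmf]].
  assert (HA : forall r, r <= 0 -> contOn n Om (A r)).
  { intros r Hr. apply sol_contC. apply Tlt_le_trans with 0; [lra|exact HT0]. }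
  assert (E : Rabs (tau0 x - tau 0 x) <= (0 + 0 * tau 0 x) / m).
  { apply (delay_stability (fun s => f (A s) x) (fun s => f (A s) x) 0 _ _ I I); auto.
    - intros a Ha. apply sol_f_ex_RInt; auto.
    - rewrite Rminus_diag, Rabs_R0. lra.
    - intros. rewrite Rminus_diag, Rabs_R0. lra.
    - intros r Hr. left. apply Hf; auto.
    - intros r Hr. apply Hmf; [apply HA; lra|apply HK; exact Hr|exact Hx].
    - lra. }
  replace ((0 + 0 * tau 0 x) / m) with 0 in E by (field; lra).
  pose proof (Rabs_pos (tau0 x - tau 0 x)).
  destruct (Req_dec (tau0 x - tau 0 x) 0) as [|Hn]; [lra|]. apply Rabs_pos_lt in Hn; lra.
Qed.

(** The margin of 1 keeps the delays of nearby solutions below [D]. *)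
Lemma sol_bounds (t1 : R) : 0 <= t1 -> Tlt t1 T ->
  exists D K, 1 <= D /\ 0 <= K /\
    (forall t x, 0 <= t <= t1 -> Om x -> tau t x <= D - 1) /\
    (forall t, - D <= t <= t1 -> suple Om (A t) K).
Proof.
  intros Ht1 HT.
  destruct (contC_bounded _ tau 0 t1 HO sol_tau_contC) as [D [HD HtauD]].
  { intros t Ht. split; [lra|]. apply Tlt_le_trans with t1; [lra|exact HT]. }
  destruct (contC_bounded _ A (- (D + 1)) t1 HO sol_contC) as [K [HK HAK]].
  { intros t Ht. apply Tlt_le_trans with t1; [lra|exact HT]. }
  exists (D + 1), K. repeat split; auto; try lra.
  intros t x Ht Hx. pose proof (HtauD t Ht x Hx) as H. apply Rabs_le_between in H. lra.
Qed.

Lemma sol_admissible (l D K : R) : 0 <= l -> Tlt l T ->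
  (forall x, Om x -> tau l x <= D) -> (forall t, - D <= t <= l -> suple Om (A t) K) ->
  admissible (Rmax K D) (A l) (tau l) (fun y z => A (l - tau l y) z).
Proof.
  intros Hl HT HD HK.
  assert (Hr : forall y, Om y -> - D <= l - tau l y <= l).
  { intros y Hy. specialize (HD y Hy). pose proof (sol_tau_nonneg l y Hl HT Hy). lra. }
  assert (Htau : contOn n Om (tau l)) by (apply sol_tau_contC; auto).
  repeat split.
  - apply sol_contC, HT.
  - exact Htau.
  - apply (contOn2_evaluation (fun t => Tlt t T)); [apply sol_contC| |].
    + apply contOn_minus; [apply contOn_const|exact Htau].
    + intros x Hx. apply Tlt_le_trans with l; [apply Hr; exact Hx|exact HT].
  - intros x Hx. eapply Rle_trans; [|apply Rmax_l]. apply HK; auto.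
    pose proof (Hr x Hx). pose proof (HD x Hx). lra.
  - intros x Hx. eapply Rle_trans; [|apply Rmax_r].
    rewrite Rabs_pos_eq; [apply HD; exact Hx|apply sol_tau_nonneg; auto].
  - intros x y Hx Hy. eapply Rle_trans; [|apply Rmax_l]. apply HK; auto.
Qed.

Lemma rhs_contC : contC n Om (fun t => 0 <= t /\ Tlt t T) (rhs F A tau).
Proof.
  split.
  - intros t [Ht HT]. destruct (sol_bounds t Ht HT) as [D [K [HD [HK [HtD HAK]]]]].
    destruct (sol_admissible t D K Ht HT) as (a1 & a2 & a3 & _); auto.
    { intros x Hx. specialize (HtD t x ltac:(lra) Hx). lra. }
    apply HF; assumption.
  - intros t [Ht HT] eps He.
    destruct (Tlt_between t T HT) as [t1 [Ht1 HT1]].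
    destruct (sol_bounds t1 ltac:(lra) HT1) as [D [K [HD [HK [HtD HAK]]]]].
    destruct (F_lipschitz F HF (Rmax K D)) as [L [HL Hlip]].
    assert (He' : 0 < eps / L) by (apply Rdiv_lt_0_compat; lra).
    destruct (contC_unif_cont _ A (- D) t1 sol_contC) with (eps := eps / L) as [d1 [Hd1 K1]].
    { intros s Hs. apply Tlt_le_trans with t1; [lra|exact HT1]. }
    { exact He'. }
    destruct sol_tau_contC as [_ Hc].
    (* The delayed time moves by at most d1 / 2 through the delay and less than d1 / 2 through [s],
       hence by less than [d1]. *)
    destruct (Hc t (conj Ht HT) (Rmin (eps / L) (d1 / 2))) as [d2 [Hd2 K2]].
    { apply Rmin_glb_lt; lra. }
    exists (Rmin (t1 - t) (Rmin (d1 / 2) d2)).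
    split; [repeat apply Rmin_glb_lt; lra|].
    intros s [Hs HsT] Hst.
    pose proof (Rlt_le_trans _ _ _ Hst (Rmin_l _ _)) as E1.
    pose proof (Rlt_le_trans _ _ _ Hst (Rmin_r _ _)) as E2.
    pose proof (Rlt_le_trans _ _ _ E2 (Rmin_l _ _)) as E3.
    pose proof (Rlt_le_trans _ _ _ E2 (Rmin_r _ _)) as E4.
    apply Rabs_def2 in E1.
    assert (adm : forall r, 0 <= r <= t1 -> admissible (Rmax K D) (A r) (tau r)
                    (fun y z => A (r - tau r y) z)).
    { intros r Hr. apply sol_admissible; [lra|apply Tlt_le_trans with t1; [lra|exact HT1]| |].
      - intros x Hx. specialize (HtD r x Hr Hx). lra.
      - intros r' Hr'. apply HAK. lra. }
    replace eps with (L * (eps / L)) by (field; lra).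
    apply Hlip; [apply adm; lra|apply adm; lra|lra|].
    specialize (K2 s (conj Hs HsT) E4). repeat split.
    + apply K1; lra.
    + intros x Hx. eapply Rle_trans; [apply K2; exact Hx|apply Rmin_l].
    + intros x y Hx Hy. apply K1; [| | |exact Hy].
      * pose proof (HtD s x ltac:(lra) Hx). pose proof (sol_tau_nonneg s x Hs HsT Hx). lra.
      * pose proof (HtD t x ltac:(lra) Hx). pose proof (sol_tau_nonneg t x Ht HT Hx). lra.
      * pose proof (Rle_trans _ _ _ (K2 x Hx) (Rmin_r _ _)) as E5. simpl in E5.
        apply Rabs_le_between in E5. apply Rabs_def2 in E3. apply Rabs_def1; lra.
Qed.

Lemma rhs_initial (x : pt) : contC n Om Ineg phi -> Cplus n Om tau0 -> Om x ->
  F (phi 0) tau0 (delayed phi tau0) x = rhs F A tau 0 x.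
Proof.
  intros Hphi [Hc H0] Hx. assert (HT0 : Tlt 0 T) by apply Hsol.
  destruct (sol_bounds 0 (Rle_refl 0) HT0) as [D [K [HD [HK [HtD HAK]]]]].
  assert (Etau : forall y, Om y -> tau 0 y = tau0 y).
  { intros y Hy. apply sol_tau_initial; auto. }
  assert (H0D : forall y, Om y -> 0 <= tau0 y <= D).
  { intros y Hy. rewrite <- (Etau y Hy) at 2. specialize (HtD 0 y ltac:(lra) Hy).
    specialize (H0 y Hy). lra. }
  assert (HphiK : forall t, - D <= t <= 0 -> suple Om (phi t) K).
  { intros t Ht y Hy. rewrite <- (sol_history t y) by (lra || assumption). apply HAK; auto. }
  apply (F_ext F (Rmax K D)); auto.
  - repeat split.
    + apply Hphi; unfold Ineg; lra.
    + exact Hc.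
    + apply (contOn2_evaluation Ineg phi (fun y => - tau0 y)); auto.
      * apply contOn_ext with (fun y => -1 * tau0 y); [intros; ring|].
        apply contOn_scal, Hc.
      * intros y Hy. specialize (H0 y Hy). unfold Ineg; lra.
    + intros y Hy. eapply Rle_trans; [|apply Rmax_l]. apply HphiK; auto; lra.
    + intros y Hy. eapply Rle_trans; [|apply Rmax_r]. specialize (H0D y Hy).
      rewrite Rabs_pos_eq; lra.
    + intros y z Hy Hz. eapply Rle_trans; [|apply Rmax_l]. specialize (H0D y Hy).
      apply HphiK; auto; lra.
  - apply sol_admissible; auto; [lra|]. intros y Hy. rewrite Etau by exact Hy. apply H0D; exact Hy.
  - repeat split.
    + intros y Hy. rewrite sol_history, Rminus_diag, Rabs_R0 by (lra || assumption). lra.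
    + intros y Hy. rewrite Etau, Rminus_diag, Rabs_R0 by assumption. lra.
    + intros y z Hy Hz. rewrite Etau by exact Hy. specialize (H0 y Hy). unfold delayed.
      rewrite sol_history, Rminus_0_l, Rminus_diag, Rabs_R0 by (lra || assumption). lra.
Qed.

(** * C^1 regularity across time 0 and invariance *)

Context {dphi : R -> pt -> R} {alpha : R}
  (Hbuc : BUC1 n Om alpha phi dphi) (Htau0 : Cplus n Om tau0)
  (Hcompat : forall x, Om x -> dphi 0 x = F (phi 0) tau0 (delayed phi tau0) x).

Lemma history_matches_rhs (x : pt) : Om x -> dphi 0 x = rhs F A tau 0 x.
Proof. intros Hx. rewrite Hcompat by exact Hx. apply rhs_initial; auto. apply Hbuc. Qed.

Lemma sol_deriv_contC : contC n Om (fun t => Tlt t T) (glue dphi (rhs F A tau)).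
Proof. apply contC_glue; [apply Hbuc|apply rhs_contC|exact history_matches_rhs]. Qed.

Lemma sol_hasDeriv : hasDeriv Om (fun t => Tlt t T) A (glue dphi (rhs F A tau)).
Proof.
  apply hasDeriv_glue; [| |exact history_matches_rhs].
  - apply hasDeriv_ext with phi dphi; [|reflexivity|apply Hbuc].
    intros t x Ht Hx. symmetry. apply sol_history; auto.
  - apply (hasDeriv_of_integral (n := n)); [| |exact rhs_contC].
    + intros s r t [Hs HsT] [Ht HtT] Hr. revert Hr. unfold Rmin, Rmax.
      destruct (Rle_dec s t); intros Hr; (split; [lra|]).
      * apply Tlt_le_trans with t; [lra|assumption].
      * apply Tlt_le_trans with s; [lra|assumption].
    + intros s t x [Hs HsT] [Ht HtT] Hx. apply sol_integral; auto.
Qed.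

Lemma sol_wt_BUC : BUCfun n Om (wt alpha A).
Proof.
  apply BUCfun_ext with (wt alpha phi); [|apply Hbuc].
  intros t x Ht Hx. unfold wt. rewrite sol_history; auto.
Qed.

Lemma sol_deriv_wt_BUC : BUCfun n Om (wt alpha (glue dphi (rhs F A tau))).
Proof.
  apply BUCfun_ext with (wt alpha dphi).
  - intros t x Ht Hx. unfold wt. rewrite glue_neg; auto.
  - apply (BUCfun_wt_deriv alpha phi dphi); apply Hbuc.
Qed.

Lemma sol_shift_hasDeriv (t : R) : Tlt t T ->
  hasDeriv Om Ineg (shift A t) (shift (glue dphi (rhs F A tau)) t).
Proof.
  intros HT. apply hasDeriv_sub with (fun th => Tlt (t + th) T).
  - intros th Hth. apply Tlt_le_trans with t; [unfold Ineg in Hth; lra|exact HT].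
  - apply (hasDeriv_shift (fun t => Tlt t T)), sol_hasDeriv.
Qed.

Lemma sol_InD (t : R) : 0 <= t -> Tlt t T -> InD n Om F alpha (shift A t) (tau t).
Proof.
  intros Ht HT.
  assert (Hsub : forall th, Ineg th -> Tlt (t + th) T).
  { intros th Hth. apply Tlt_le_trans with t; [unfold Ineg in Hth; lra|exact HT]. }
  assert (Hsub' : forall r, r <= t -> Tlt r T).
  { intros r Hr. apply Tlt_le_trans with t; assumption. }
  assert (W : BUCfun n Om (wt alpha (shift A t))).
  { apply BUCfun_wt_shift; [exact Ht| |exact sol_wt_BUC].
    exact (contC_sub _ _ _ Hsub' sol_contC). }
  exists (shift (glue dphi (rhs F A tau)) t). split; [split; [|split; [|split; [|split]]]|split; [split|]].
  - apply (contC_sub _ _ _ Hsub), (contC_shift (fun r => Tlt r T)), sol_contC.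
  - exact (sol_shift_hasDeriv t HT).
  - apply (contC_sub _ _ _ Hsub), (contC_shift (fun r => Tlt r T)), sol_deriv_contC.
  - exact W.
  - apply BUCfun_dwt; [exact W|]. apply BUCfun_wt_shift; [exact Ht| |exact sol_deriv_wt_BUC].
    exact (contC_sub _ _ _ Hsub' sol_deriv_contC).
  - apply sol_tau_contC; auto.
  - intros x Hx; apply sol_tau_nonneg; auto.
  - intros x Hx. unfold shift. rewrite Rplus_0_r.
    (* The delayed argument of the shifted history and the one inside [rhs] are convertible, so
       compatibility at time t is the differential equation itself. *)
    apply glue_nonneg; [apply history_matches_rhs; exact Hx|exact Ht].
Qed.

End Semiflow.

(** * Continuous dependence on the initial data *)

(** All shifts at times s <= t1 are read off the single weighted history [V] ending at [t1]: the
    weighted shift is exp(alpha (t1 - s)) V(s + th - t1). Continuity in s then splits into uniform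
    continuity of [V] and continuity of a scalar factor. Taking t1 > t leaves room for s > t. *)
Lemma wt_shift_close {n Om} (alpha : R) (B : R -> pt -> R) (t t1 : R) :
  Omega_hyp n Om -> 0 <= t < t1 -> contC n Om (fun r => r <= t1) B -> BUCfun n Om (wt alpha B) ->
  forall eps, eps > 0 -> exists d, d > 0 /\ forall s, s <= t1 -> Rabs (s - t) < d ->
    forall th, th <= 0 ->
      suple Om (fun x => wt alpha (shift B t) th x - wt alpha (shift B s) th x) eps.
Proof.
  intros HO Ht Hc HB eps He.
  destruct (BUCfun_wt_shift HO alpha B t1 ltac:(lra) Hc HB) as [_ [[M HM] HV]].
  set (V := wt alpha (shift B t1)) in *.
  set (w := fun s => exp (alpha * (t1 - s))).
  assert (EV : forall s th x, s <= t1 -> th <= 0 ->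
            wt alpha (shift B s) th x = w s * V (s + th - t1) x).
  { intros s th x Hs Hth. unfold V, w, wt, shift. rewrite !exp_weight_nonpos by lra.
    rewrite <- Rmult_assoc, <- exp_plus. replace (t1 + (s + th - t1)) with (s + th) by ring.
    do 2 f_equal. ring. }
  assert (Hw : 0 < w t) by apply exp_pos.
  set (M' := Rabs M + 1). assert (HM' : 0 < M') by (unfold M'; pose proof (Rabs_pos M); lra).
  destruct (HV (eps / (2 * w t))) as [d1 [Hd1 K1]]; [apply Rdiv_lt_0_compat; lra|].
  assert (Cw : continuous w t).
  { apply (continuous_comp (fun s => alpha * (t1 - s)) exp); [|apply continuous_exp].
    apply (continuous_scal_r alpha (fun s => t1 - s)).
    apply (continuous_minus (fun _ => t1) (fun s => s));
      [apply continuous_const|apply continuous_id]. }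
  assert (He2 : 0 < eps / (2 * M')) by (apply Rdiv_lt_0_compat; lra).
  destruct (proj1 (filterlim_locally w (w t)) Cw (mkposreal _ He2)) as [d2 K2].
  exists (Rmin d1 d2). split; [apply Rmin_glb_lt; [assumption|apply cond_pos]|].
  intros s Hs Hst th Hth x Hx. rewrite !EV by lra.
  specialize (K2 s (Rlt_le_trans _ _ _ Hst (Rmin_r _ _))).
  change (Rabs (w s - w t) < eps / (2 * M')) in K2.
  assert (K : Rabs (V (s + th - t1) x - V (t + th - t1) x) <= eps / (2 * w t)).
  { apply K1; [lra|lra| |exact Hx].
    replace (s + th - t1 - (t + th - t1)) with (s - t) by ring.
    eapply Rlt_le_trans; [exact Hst|apply Rmin_l]. }
  assert (HMV : Rabs (V (s + th - t1) x) <= M').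
  { eapply Rle_trans; [apply HM; [lra|exact Hx]|]. unfold M'. pose proof (RRle_abs M). lra. }
  rewrite Rabs_minus_sym.
  replace (w s * V (s + th - t1) x - w t * V (t + th - t1) x)
    with (w t * (V (s + th - t1) x - V (t + th - t1) x) + (w s - w t) * V (s + th - t1) x)
    by ring.
  eapply Rle_trans; [apply Rabs_triang|].
  pose proof (Rabs_mult_le _ _ _ _ (Req_le _ _ (Rabs_pos_eq _ (Rlt_le _ _ Hw))) K) as E1.
  pose proof (Rabs_mult_le _ _ _ _ (Rlt_le _ _ K2) HMV) as E2.
  replace (w t * (eps / (2 * w t))) with (eps / 2) in E1 by (field; lra).
  replace (eps / (2 * M') * M') with (eps / 2) in E2 by (field; lra). lra.
Qed.

(** As alpha >= 0, shifting forward can only lower the weight of the old history, and the weight is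
    at most 1 on the part lived since time 0. *)
Lemma wt_shift_diff {Om : pt -> Prop} (alpha : R) (B B' : R -> pt -> R) (s e : R) :
  0 <= alpha -> 0 <= s ->
  (forall t, t <= 0 -> suple Om (fun x => wt alpha B t x - wt alpha B' t x) e) ->
  (forall r, 0 <= r <= s -> suple Om (fun x => B r x - B' r x) e) ->
  forall th, th <= 0 ->
    suple Om (fun x => wt alpha (shift B s) th x - wt alpha (shift B' s) th x) e.
Proof.
  intros Ha Hs Hneg Hpos th Hth x Hx.
  unfold wt, shift. rewrite <- Rmult_minus_distr_l.
  rewrite exp_weight_nonpos by exact Hth. rewrite Rabs_mult, (Rabs_pos_eq (exp _))
    by (left; apply exp_pos).
  assert (Hle : forall y z, y <= z -> exp y <= exp z).
  { intros y z [H| ->]; [left; apply exp_increasing; exact H|right; reflexivity]. }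
  destruct (Rle_lt_dec (s + th) 0) as [H|H].
  - eapply Rle_trans; [|apply (Hneg (s + th) H x Hx)].
    unfold wt. rewrite <- Rmult_minus_distr_l, exp_weight_nonpos by exact H.
    rewrite Rabs_mult, (Rabs_pos_eq (exp _)) by (left; apply exp_pos).
    apply Rmult_le_compat_r; [apply Rabs_pos|]. apply Hle. nra.
  - eapply Rle_trans; [|apply (Hpos (s + th) ltac:(lra) x Hx)].
    rewrite <- (Rmult_1_l (Rabs _)) at 2. apply Rmult_le_compat_r; [apply Rabs_pos|].
    rewrite <- exp_0. apply Hle. nra.
Qed.

Section ContinuousDependence.

Context {n : nat} {Om : pt -> Prop} {F : Ftype} {f : (pt -> R) -> pt -> R} {Mf alpha : R}
  (HO : Omega_hyp n Om) (HF : F_hyp n Om F) (Hf : f_hyp n Om f Mf) (Halpha : 0 <= alpha).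
Context {phi dphi : R -> pt -> R} {tau0 : pt -> R} {A tau : R -> pt -> R} {T : option R}
  (Hsol : is_solution n Om F f phi tau0 A tau T)
  (Hbuc : BUC1 n Om alpha phi dphi) (Htau0 : Cplus n Om tau0)
  (Hcompat : forall x, Om x -> dphi 0 x = F (phi 0) tau0 (delayed phi tau0) x).

(** Compatibility enters here: it makes the derivative continuous across 0, hence bounded on all of
    [a, t1], history included. *)
Lemma sol_lipschitz (a t1 : R) : Tlt t1 T -> exists L, 0 <= L /\
  forall s r x, a <= s <= t1 -> a <= r <= t1 -> Om x ->
    Rabs (A s x - A r x) <= L * Rabs (s - r).
Proof.
  intros HT.
  assert (Hin : forall r, r <= t1 -> Tlt r T) by (intros; apply Tlt_le_trans with t1; assumption).
  destruct (contC_bounded _ (glue dphi (rhs F A tau)) a t1 HO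
              (sol_deriv_contC HO HF Hf Hsol Hbuc Htau0 Hcompat)) as [L [HL HLb]].
  { intros r Hr; apply Hin; lra. }
  exists L; split; [exact HL|]. intros s r x Hs Hr Hx.
  destruct (MVT_gen (fun u => A u x) r s (fun u => glue dphi (rhs F A tau) u x))
    as [c [Hc E]].
  - intros u Hu. assert (u <= t1) by (revert Hu; unfold Rmax; destruct (Rle_dec r s); lra).
    apply (hasDeriv_is_derive (Om := Om) (fun t => Tlt t T) A); auto.
    + apply (sol_hasDeriv HO HF Hf Hsol Hbuc Htau0 Hcompat).
    + apply Tlt_locally, Hin; assumption.
  - intros u Hu. assert (u <= t1) by (revert Hu; unfold Rmax; destruct (Rle_dec r s); lra).
    apply continuity_pt_filterlim.
    apply (contC_continuous (n := n) (Om := Om) (fun t => Tlt t T) A); auto.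
    + apply (sol_contC Hsol).
    + apply Tlt_locally, Hin; assumption.
  - rewrite E, Rabs_mult. apply Rmult_le_compat_r; [apply Rabs_pos|]. apply HLb; [|exact Hx].
    revert Hc; unfold Rmin, Rmax; destruct (Rle_dec r s); lra.
Qed.

(** The instantaneous estimate behind the Gronwall argument: an error [e] of [A] on [-D, l] and of
    the initial delay controls the delay and the velocity at time [l], with constants taken from the
    reference solution only. *)
Lemma sol_comparison (t1 : R) : 0 <= t1 -> Tlt t1 T ->
  exists D C e0, 0 <= D /\ 0 < C /\ 0 < e0 /\
  forall phi' tau0' A' tau' T' e l,
    is_solution n Om F f phi' tau0' A' tau' T' -> (forall x, Om x -> 0 <= tau0' x) ->
    0 <= e <= e0 -> 0 <= l <= t1 -> Tlt l T' ->
    suple Om (fun x => tau0' x - tau0 x) e ->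
    (forall r, - D <= r <= l -> suple Om (fun x => A' r x - A r x) e) ->
    suple Om (fun x => tau' l x - tau l x) (C * e) /\
    suple Om (fun x => rhs F A' tau' l x - rhs F A tau l x) (C * e).
Proof.
  intros Ht1 HT.
  destruct (sol_bounds HO Hsol t1 Ht1 HT) as [D [K [HD [HK [HtauD HAK]]]]].
  destruct (sol_lipschitz (- D) t1 HT) as [LA [HLA HAlip]].
  destruct (F_lipschitz F HF (Rmax (K + 1) D)) as [L [HL HFlip]].
  destruct (f_lipschitz f Mf Hf) as [Lf [HLf Hflip]].
  destruct (f_lower_bound HO f Mf (K + 1) Hf) as [m [Hm Hmf]].
  (* One [Lf * D] for the integrand over the initial window, one for the window at time [l],
     [Rabs Mf] for the displaced end point -tau0; the 1 ensures positivity. *)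
  set (G := 2 * Lf * D + Rabs Mf + 1).
  assert (HG : 0 < G) by (unfold G; pose proof (Rabs_pos Mf); nra).
  set (C1 := G / m). assert (HC1 : 0 < C1) by (apply Rdiv_lt_0_compat; assumption).
  (* The delayed term costs e for replacing [A'] by [A], and [LA * C1 * e] for moving the delay. *)
  set (C2 := 1 + (1 + LA) * C1). assert (HC2 : 1 <= C2) by (unfold C2; nra).
  assert (HC12 : C1 <= C2) by (unfold C2; pose proof (Rmult_le_pos LA C1 HLA ltac:(lra)); lra).
  (* e <= 1 keeps [A'] below K + 1. C1 e <= 1/2 gives the smallness G e < m for [delay_stability]
     and keeps [tau'] below [D]. *)
  exists D, ((L + 1) * C2), (Rmin 1 (/ (2 * C1))).
  split; [lra|]. split; [nra|].
  split; [apply Rmin_glb_lt; [lra|apply Rinv_0_lt_compat; lra]|].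
  intros phi' tau0' A' tau' T' e l Hsol' Htau0' He Hl HT' Htt HAA.
  assert (He1 : e <= 1) by (eapply Rle_trans; [apply He|apply Rmin_l]).
  assert (He2 : C1 * e <= / 2).
  { apply Rle_trans with (C1 * / (2 * C1)).
    - apply Rmult_le_compat_l; [lra|]. eapply Rle_trans; [apply He|apply Rmin_r].
    - right; field; lra. }
  assert (HTl : forall r, r <= l -> Tlt r T) by (intros; apply Tlt_le_trans with t1; [lra|exact HT]).
  assert (HTl' : forall r, r <= l -> Tlt r T') by (intros; apply Tlt_le_trans with l; assumption).
  assert (cA : forall r, r <= l -> contOn n Om (A r))
    by (intros; apply (sol_contC Hsol), HTl; assumption).
  assert (cA' : forall r, r <= l -> contOn n Om (A' r))
    by (intros; apply (sol_contC Hsol'), HTl'; assumption).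
  assert (bA' : forall r, - D <= r <= l -> suple Om (A' r) (K + 1)).
  { intros r Hr x Hx. apply Rabs_le_near with (A r x); [apply HAK; [lra|exact Hx]|].
    eapply Rle_trans; [apply HAA; assumption|exact He1]. }
  assert (Hfdiff : forall r x, - D <= r <= l -> Om x -> Rabs (f (A r) x - f (A' r) x) <= Lf * e).
  { intros r x Hr Hx. rewrite Rabs_minus_sym. apply Hflip; auto; [apply cA'; lra|apply cA; lra|lra]. }
  assert (Htau : suple Om (fun x => tau' l x - tau l x) (C1 * e)).
  { intros x Hx.
    assert (E0 : tau 0 x = tau0 x) by (apply (sol_tau_initial HO Hf Hsol); [apply Htau0|exact Hx]).
    assert (H0 : 0 <= tau0 x <= D - 1).
    { split; [apply Htau0, Hx|]. rewrite <- E0. apply HtauD; [lra|exact Hx]. }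
    assert (Htl : 0 <= tau l x <= D - 1).
    { split; [apply (sol_tau_nonneg Hsol); auto; [lra|apply HTl; lra]|apply HtauD; auto]. }
    destruct (sol_delay Hf Hsol l x ltac:(lra) (HTl l ltac:(lra)) Hx ltac:(lra)) as [I [I1 I2]].
    destruct (sol_delay Hf Hsol' l x ltac:(lra) HT' Hx (Htau0' x Hx)) as [I' [I1' I2']].
    assert (HII : Rabs (I - I') <= (Lf * D + Rabs Mf) * e).
    { destruct (sol_f_ex_RInt Hf Hsol' (0 - tau0 x) 0 x) as [J HJ]; [lra|apply HTl'; lra|exact Hx|].
      assert (E1 : Rabs (I - J) <= Lf * e * D).
      { pose proof (is_RInt_minus _ _ _ _ _ _ I2 HJ) as HD'.
        apply (RInt_bound _ _ _ _ (Lf * e)) in HD'.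
        - replace (0 - (0 - tau0 x)) with (tau0 x) in HD' by ring.
          rewrite (Rabs_pos_eq (tau0 x)) in HD' by lra.
          eapply Rle_trans; [exact HD'|]. apply Rmult_le_compat_l; [nra|lra].
        - intros r Hr. rewrite Rmin_left, Rmax_right in Hr by lra.
          apply Hfdiff; [lra|exact Hx]. }
      pose proof (Htt x Hx) as E3. simpl in E3. pose proof (Htau0' x Hx).
      (* The two initial windows differ by an interval of length at most [e], on which 0 < f <=
         Mf. *)
      assert (E2 : Rabs (J - I') <= Rabs Mf * e).
      { pose proof (is_RInt_sub _ _ _ _ _ _ (is_RInt_swap _ _ _ _ I2') (is_RInt_swap _ _ _ _ HJ))
          as HD'.
        change (is_RInt (fun s => f (A' s) x) (0 - tau0' x) (0 - tau0 x) (- J - - I')) in HD'.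
        apply (RInt_bound _ _ _ _ (Rabs Mf)) in HD'.
        - rewrite <- Rabs_Ropp. replace (- (J - I')) with (- J - - I') by ring.
          eapply Rle_trans; [exact HD'|]. apply Rmult_le_compat_l; [apply Rabs_pos|].
          replace (0 - tau0 x - (0 - tau0' x)) with (tau0' x - tau0 x) by ring. exact E3.
        - intros r Hr.
          assert (Hr0 : r <= 0).
          { revert Hr; unfold Rmax; destruct (Rle_dec (0 - tau0' x) (0 - tau0 x)); lra. }
          destruct Hf as (_ & _ & Hfpos & _).
          destruct (Hfpos (A' r) x (cA' r ltac:(lra)) Hx) as [P1 P2].
          rewrite Rabs_pos_eq by lra. eapply Rle_trans; [exact P2|apply RRle_abs]. }
      replace ((Lf * D + Rabs Mf) * e) with (Lf * e * D + Rabs Mf * e) by ring.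
      eapply Rabs_le_sub; eassumption. }
    assert (Hsum : (Lf * D + Rabs Mf) * e + Lf * e * tau l x <= G * e).
    { unfold G. assert (Lf * e * tau l x <= Lf * e * D) by (apply Rmult_le_compat_l; nra). nra. }
    assert (HGm : G * e < m).
    { replace (G * e) with (m * (C1 * e)) by (unfold C1; field; lra). nra. }
    eapply Rle_trans.
    - apply (delay_stability (fun s => f (A s) x) (fun s => f (A' s) x) l (tau l x) (tau' l x)
               I I' ((Lf * D + Rabs Mf) * e) (Lf * e) m); auto.
      + intros a Ha. apply (sol_f_ex_RInt Hf Hsol'); auto.
      + lra.
      + apply (sol_tau_nonneg Hsol'); auto; lra.
      + intros r Hr. apply Hfdiff; [lra|exact Hx].
      + intros r Hr. left. apply Hf; auto.
      + intros r Hr. apply Hmf; [apply cA'; lra|apply bA'; lra|exact Hx].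
      + lra.
    - unfold C1, Rdiv. rewrite (Rmult_comm (G * / m)), <- Rmult_assoc, (Rmult_comm e G).
      apply Rmult_le_compat_r; [left; apply Rinv_0_lt_compat; exact Hm|exact Hsum]. }
  split.
  - intros x Hx. eapply Rle_trans; [apply Htau; exact Hx|].
    apply Rmult_le_compat_r; [lra|]. nra.
  - assert (Htau'D : forall x, Om x -> tau' l x <= D).
    { intros x Hx. pose proof (Htau x Hx) as H. simpl in H. apply Rabs_le_between in H.
      pose proof (HtauD l x Hl Hx). lra. }
    intros x Hx. apply Rle_trans with (L * (C2 * e)); [|nra].
    apply HFlip; [| |nra| |exact Hx].
    + apply (sol_admissible Hsol'); auto; lra.
    + apply (sol_admissible Hsol); [lra|apply HTl; lra| |].
      * intros y Hy. pose proof (HtauD l y Hl Hy). lra.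
      * intros r Hr y Hy. pose proof (HAK r ltac:(lra) y Hy). lra.
    + repeat split.
      * intros y Hy. eapply Rle_trans; [apply HAA; [lra|exact Hy]|]. nra.
      * intros y Hy. eapply Rle_trans; [apply Htau; exact Hy|].
        apply Rmult_le_compat_r; lra.
      * intros y z Hy Hz.
        pose proof (Htau'D y Hy). pose proof (HtauD l y Hl Hy).
        pose proof (sol_tau_nonneg Hsol' l y ltac:(lra) HT' Hy).
        pose proof (sol_tau_nonneg Hsol l y ltac:(lra) (HTl l ltac:(lra)) Hy).
        pose proof (HAA (l - tau' l y) ltac:(lra) z Hz) as E1. simpl in E1.
        pose proof (HAlip (l - tau' l y) (l - tau l y) z ltac:(lra) ltac:(lra) Hz) as E2.
        replace (l - tau' l y - (l - tau l y)) with (- (tau' l y - tau l y)) in E2 by ring.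
        rewrite Rabs_Ropp in E2. pose proof (Htau y Hy) as E3. simpl in E3.
        pose proof (Rmult_le_compat_l LA _ _ HLA E3) as E4.
        pose proof (Rabs_le_sub _ _ _ _ _ E1 (Rle_trans _ _ _ E2 E4)) as E5.
        eapply Rle_trans; [exact E5|]. unfold C2. nra.
Qed.

(** Gronwall's inequality by a continuity argument: the barrier [E' = C0 E], started at twice the
    initial error, is never reached. *)
Lemma sol_continuous_dependence (t1 : R) : 0 <= t1 -> Tlt t1 T ->
  exists C d0, 0 < C /\ 0 < d0 /\
  forall phi' tau0' A' tau' T' d l,
    is_solution n Om F f phi' tau0' A' tau' T' -> (forall x, Om x -> 0 <= tau0' x) ->
    0 < d <= d0 ->
    (forall t, t <= 0 -> suple Om (fun x => wt alpha phi' t x - wt alpha phi t x) d) ->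
    suple Om (fun x => tau0' x - tau0 x) d ->
    0 <= l <= t1 -> Tlt l T' ->
    suple Om (fun x => A' l x - A l x) (C * d) /\
    suple Om (fun x => tau' l x - tau l x) (C * d) /\
    suple Om (fun x => rhs F A' tau' l x - rhs F A tau l x) (C * d).
Proof.
  intros Ht1 HT.
  destruct (sol_comparison t1 Ht1 HT) as [D [C0 [e0 [HD [HC0 [He0 Hstep]]]]]].
  (* The value of the barrier at [t1] per unit of [d]: 2 for its start, exp(alpha D) for removing
     the weight on [-D, 0], exp(C0 t1) for its growth. *)
  set (C1 := 2 * exp (alpha * D) * exp (C0 * t1)).
  assert (HC1 : 0 < C1).
  { unfold C1. pose proof (exp_pos (alpha * D)). pose proof (exp_pos (C0 * t1)). nra. }
  assert (Hexp1 : forall y, 0 <= y -> 1 <= exp y).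
  { intros y Hy. pose proof (exp_ineq1_le y). lra. }
  (* C0 + 1 covers both the bound E for [A] and C0 E for the delay and velocity; d <= e0 / C1 keeps
     E within the range of [sol_comparison]. *)
  exists ((C0 + 1) * C1), (e0 / C1).
  split; [nra|]. split; [apply Rdiv_lt_0_compat; assumption|].
  intros phi' tau0' A' tau' T' d l Hsol' Htau0' Hd Hphi Htt Hl HT'.
  set (d1 := exp (alpha * D) * d).
  assert (Hdd1 : d <= d1) by (unfold d1; pose proof (Hexp1 (alpha * D) ltac:(nra)); nra).
  set (E := fun r => 2 * d1 * exp (C0 * r)).
  assert (HE0 : E 0 = 2 * d1) by (unfold E; rewrite Rmult_0_r, exp_0; ring).
  assert (HEmono : forall r s, r <= s -> E r <= E s).
  { intros r s [H| ->]; [|right; reflexivity]. apply Rmult_le_compat_l; [lra|].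
    left; apply exp_increasing; nra. }
  assert (HEt1 : E t1 = C1 * d) by (unfold E, C1, d1; ring).
  assert (HEe0 : forall r, r <= t1 -> E r <= e0).
  { intros r Hr. apply Rle_trans with (E t1); [apply HEmono, Hr|]. rewrite HEt1.
    apply Rle_trans with (C1 * (e0 / C1)); [apply Rmult_le_compat_l; lra|right; field; lra]. }
  assert (HEpos : forall r, 0 <= E r).
  { intros r. unfold E. pose proof (exp_pos (C0 * r)). nra. }
  assert (HTl : forall r, r <= l -> Tlt r T) by (intros; apply Tlt_le_trans with t1; [lra|exact HT]).
  assert (HTl' : forall r, r <= l -> Tlt r T') by (intros; apply Tlt_le_trans with l; assumption).
  assert (Hhist : forall r, - D <= r <= 0 -> suple Om (fun x => A' r x - A r x) d1).
  { intros r Hr x Hx.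
    rewrite (sol_history Hsol r x), (sol_history Hsol' r x) by (lra || assumption).
    pose proof (Hphi r ltac:(lra) x Hx) as H. unfold wt in H.
    rewrite <- Rmult_minus_distr_l, exp_weight_nonpos in H by lra.
    rewrite Rabs_mult, (Rabs_pos_eq (exp _)) in H by (left; apply exp_pos).
    replace (Rabs (phi' r x - phi r x))
      with (exp (- (alpha * r)) * (exp (alpha * r) * Rabs (phi' r x - phi r x))).
    - unfold d1. apply Rmult_le_compat; [left; apply exp_pos| |  |exact H].
      + apply Rmult_le_pos; [left; apply exp_pos|apply Rabs_pos].
      + destruct (Req_dec (- (alpha * r)) (alpha * D)) as [->|Hn]; [lra|].
        left; apply exp_increasing. nra.
    - rewrite <- Rmult_assoc, <- exp_plus, Rplus_opp_l, exp_0. ring. }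
  assert (Hcomp : forall r, 0 <= r <= l ->
    (forall s, 0 <= s <= r -> suple Om (fun x => A' s x - A s x) (E s)) ->
    suple Om (fun x => tau' r x - tau r x) (C0 * E r) /\
    suple Om (fun x => rhs F A' tau' r x - rhs F A tau r x) (C0 * E r)).
  { intros r Hr HP. apply (Hstep phi' tau0' A' tau' T'); auto.
    - split; [apply HEpos|apply HEe0; lra].
    - lra.
    - apply HTl'; lra.
    - intros x Hx. eapply Rle_trans; [apply Htt; exact Hx|]. pose proof (HEmono 0 r ltac:(lra)). lra.
    - intros s Hs x Hx. destruct (Rle_lt_dec s 0) as [Hs0|Hs0].
      + eapply Rle_trans; [apply Hhist; [lra|exact Hx]|]. pose proof (HEmono 0 r ltac:(lra)). lra.
      + eapply Rle_trans; [apply HP; [lra|exact Hx]|]. apply HEmono; lra. }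
  assert (CB : contC n Om (fun r => r <= l) (fun r x => A' r x - A r x)).
  { apply contC_minus; [exact HO| |].
    - exact (contC_sub _ _ _ HTl' (sol_contC Hsol')).
    - exact (contC_sub _ _ _ HTl (sol_contC Hsol)). }
  assert (main : forall r, 0 <= r <= l -> suple Om (fun x => A' r x - A r x) (E r)).
  { apply interval_induction; [lra| | |].
    - intros x Hx. eapply Rle_trans; [apply Hhist; [lra|exact Hx]|]. lra.
    - intros r Hr HP.
      (* The velocity error integrates to at most E r - E 0; adding the initial error [d1] to it and
         using E 0 = 2 d1 leaves a gap [d1], which continuity uses to go past r. *)
      assert (Hgap : suple Om (fun x => A' r x - A r x) (E r - d1)).
      { intros x Hx.
        pose proof (sol_integral Hsol 0 r x ltac:(lra) (HTl 0 ltac:(lra)) ltac:(lra)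
                      (HTl r ltac:(lra)) Hx) as I1.
        pose proof (sol_integral Hsol' 0 r x ltac:(lra) (HTl' 0 ltac:(lra)) ltac:(lra)
                      (HTl' r ltac:(lra)) Hx) as I2.
        pose proof (is_RInt_minus _ _ _ _ _ _ I2 I1) as I3.
        assert (I4 : is_RInt (fun s => C0 * E s) 0 r (minus (E r) (E 0))).
        { apply (is_RInt_derive E).
          - intros s _. unfold E. auto_derive; [exact I|]. ring.
          - intros s _. unfold E. apply (ex_derive_continuous (fun s => C0 * (2 * d1 * exp (C0 * s)))).
            auto_derive. exact I. }
        assert (Hr' : forall s, 0 <= s <= r ->
                  Rabs (rhs F A' tau' s x - rhs F A tau s x) <= C0 * E s).
        { intros s Hs. apply (Hcomp s ltac:(lra)); [|exact Hx]. intros u Hu. apply HP; lra. }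
        pose proof (norm_RInt_le (fun s => minus (rhs F A' tau' s x) (rhs F A tau s x))
          (fun s => C0 * E s) 0 r _ _ ltac:(lra) Hr' I3 I4) as I5.
        change (Rabs (A' r x - A' 0 x - (A r x - A 0 x)) <= E r - E 0) in I5.
        pose proof (Hhist 0 ltac:(lra) x Hx) as I6. simpl in I6.
        replace (A' r x - A r x)
          with ((A' r x - A' 0 x - (A r x - A 0 x)) + (A' 0 x - A 0 x)) by ring.
        eapply Rle_trans; [apply Rabs_triang|]. lra. }
      destruct CB as [_ CB]. destruct (CB r ltac:(lra) d1 ltac:(lra)) as [d2 [Hd2 K2]].
      exists d2; split; [exact Hd2|]. intros s Hs Hsl x Hx.
      assert (Hsr : Rabs (s - r) < d2) by (apply Rabs_def1; lra).
      pose proof (Rabs_le_near _ _ _ _ (Hgap x Hx) (K2 s Hsl Hsr x Hx)) as H. simpl in H.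
      pose proof (HEmono r s ltac:(lra)). lra.
    - intros r Hr HP x Hx. apply le_epsilon. intros eps He.
      destruct CB as [_ CB]. destruct (CB r ltac:(lra) eps He) as [d2 [Hd2 K2]].
      set (s := Rmax 0 (r - d2 / 2)).
      assert (Hs : 0 <= s < r /\ Rabs (s - r) < d2).
      { unfold s, Rmax. destruct (Rle_dec 0 (r - d2 / 2)); split; try lra; apply Rabs_def1; lra. }
      pose proof (K2 s ltac:(lra) (proj2 Hs) x Hx) as H1. simpl in H1.
      rewrite Rabs_minus_sym in H1.
      pose proof (Rabs_le_near _ _ _ _ (HP s (proj1 Hs) x Hx) H1) as H. simpl in H.
      pose proof (HEmono s r ltac:(lra)). lra. }
  assert (HEl : E l <= C1 * d) by (rewrite <- HEt1; apply HEmono; lra).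
  destruct (Hcomp l ltac:(lra) main) as [H1 H2].
  assert (HCd : (C0 + 1) * C1 * d = C0 * (C1 * d) + C1 * d) by ring.
  assert (HC1d : 0 <= C1 * d) by (apply Rmult_le_pos; lra).
  assert (HC0C1d : 0 <= C0 * (C1 * d)) by (apply Rmult_le_pos; lra).
  assert (HEl' : C0 * E l <= (C0 + 1) * C1 * d).
  { rewrite HCd. pose proof (Rmult_le_compat_l C0 _ _ (Rlt_le _ _ HC0) HEl). lra. }
  split; [|split]; intros x Hx.
  - eapply Rle_trans; [apply main; [lra|exact Hx]|]. lra.
  - eapply Rle_trans; [apply H1; exact Hx|exact HEl'].
  - eapply Rle_trans; [apply H2; exact Hx|exact HEl'].
Qed.

End ContinuousDependence.

Lemma dD_lt_bounds {Om : pt -> Prop} (alpha : R) phi dphi tau0 phi' dphi' tau0' (d : R) :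
  0 <= alpha -> hasDeriv Om Ineg phi dphi -> hasDeriv Om Ineg phi' dphi' ->
  dD_lt Om alpha phi tau0 phi' tau0' d ->
  (forall t, t <= 0 -> suple Om (fun x => wt alpha phi t x - wt alpha phi' t x) d) /\
  (forall t, t <= 0 ->
     suple Om (fun x => wt alpha dphi t x - wt alpha dphi' t x) ((1 + alpha) * d)) /\
  suple Om (fun x => tau0 x - tau0' x) d.
Proof.
  intros Ha H1 H2 H. destruct (H dphi dphi' H1 H2) as [a [b [c [Hd [Q1 [Q2 Q3]]]]]].
  (* Nonnegativity needs a point of [Om]; without one the conclusions are vacuous. *)
  assert (pos : forall x, Om x -> 0 <= a /\ 0 <= b /\ 0 <= c).
  { intros x Hx. repeat split.
    - eapply Rle_trans; [apply Rabs_pos|apply (Q1 0 (Rle_refl 0) x Hx)].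
    - eapply Rle_trans; [apply Rabs_pos|apply (Q2 0 (Rle_refl 0) x Hx)].
    - eapply Rle_trans; [apply Rabs_pos|apply (Q3 x Hx)]. }
  split; [|split].
  - intros t Ht x Hx. destruct (pos x Hx) as (p1 & p2 & p3).
    eapply Rle_trans; [apply Q1; assumption|lra].
  - intros t Ht x Hx. destruct (pos x Hx) as (p1 & p2 & p3).
    pose proof (Q1 t Ht x Hx) as E1. pose proof (Q2 t Ht x Hx) as E2. simpl in E1, E2.
    rewrite !dwt_split in E2.
    apply Rabs_le_between in E1. apply Rabs_le_between in E2. apply Rabs_le_between.
    split; nra.
  - intros x Hx. destruct (pos x Hx) as (p1 & p2 & p3).
    eapply Rle_trans; [apply Q3; assumption|lra].
Qed.

(** Triangle inequality through the reference solution at the perturbed time s: continuity in time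
    concerns the reference solution alone, and dependence on data is used at equal times. *)
Lemma semiflow_continuous {n Om F f Mf alpha} phi tau0 A tau T t :
  Omega_hyp n Om -> 0 <= alpha -> F_hyp n Om F -> f_hyp n Om f Mf ->
  InD n Om F alpha phi tau0 -> is_solution n Om F f phi tau0 A tau T -> 0 <= t -> Tlt t T ->
  forall eps, eps > 0 -> exists d, d > 0 /\
    forall phi' tau0' A' tau' T' s,
      InD n Om F alpha phi' tau0' -> is_solution n Om F f phi' tau0' A' tau' T' ->
      0 <= s -> Tlt s T' -> Rabs (s - t) < d ->
      dD_lt Om alpha phi tau0 phi' tau0' d ->
      dD_lt Om alpha (shift A t) (tau t) (shift A' s) (tau' s) eps.
Proof.
  intros HO Ha HF Hf [dphi [Hbuc [Htau0 Hcompat]]] Hsol Ht HT eps He.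
  destruct (Tlt_between t T HT) as [t1 [Ht1 HT1]].
  destruct (sol_continuous_dependence HO HF Hf Ha Hsol Hbuc Htau0 Hcompat t1 ltac:(lra) HT1)
    as [C [d0 [HC [Hd0 Hdep]]]].
  (* The three distances end up as 2e, 2(1 + alpha)e and 2e, in total at most 6 eps / 8. *)
  set (e := eps / (8 * (1 + alpha))).
  assert (Hee : 0 < e) by (apply Rdiv_lt_0_compat; lra).
  assert (Hin : forall r, r <= t1 -> Tlt r T) by (intros; apply Tlt_le_trans with t1; assumption).
  destruct (wt_shift_close alpha A t t1 HO ltac:(lra)
              (contC_sub _ _ _ Hin (sol_contC Hsol)) (sol_wt_BUC Hsol Hbuc) e Hee)
    as [d1 [Hd1 K1]].
  destruct (wt_shift_close alpha _ t t1 HO ltac:(lra)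
              (contC_sub _ _ _ Hin (sol_deriv_contC HO HF Hf Hsol Hbuc Htau0 Hcompat))
              (sol_deriv_wt_BUC Hbuc) e Hee) as [d2 [Hd2 K2]].
  destruct (sol_tau_contC Hsol) as [_ Hctau].
  destruct (Hctau t (conj Ht HT) e Hee) as [d3 [Hd3 K3]].
  (* Absorbs the constant [C] and the factor 1 + alpha lost in [dD_lt_bounds]. *)
  set (d4 := Rmin (e / C) (e / (1 + alpha))).
  assert (Hd4 : 0 < d4) by (apply Rmin_glb_lt; apply Rdiv_lt_0_compat; lra).
  set (d := Rmin (Rmin d0 d4) (Rmin (t1 - t) (Rmin d1 (Rmin d2 d3)))).
  assert (Hdpos : 0 < d) by (apply Rmin_glb_lt; [apply Rmin_glb_lt; lra|repeat apply Rmin_glb_lt; lra]).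
  assert (Hdle : d <= d0 /\ d <= d4 /\ d <= t1 - t /\ d <= d1 /\ d <= d2 /\ d <= d3).
  { assert (Hr : forall a b c, a <= Rmin b c -> a <= b /\ a <= c).
    { intros a b c H. pose proof (Rmin_l b c). pose proof (Rmin_r b c). lra. }
    destruct (Hr _ _ _ (Rle_refl d)) as [Q1 Q2]. apply Hr in Q1, Q2.
    destruct Q2 as [Q2 Q3]. apply Hr in Q3. destruct Q3 as [Q3 Q4]. apply Hr in Q4. tauto. }
  destruct Hdle as (L0 & L4 & Lt & L1 & L2 & L3).
  assert (LC : C * d <= e).
  { apply Rle_trans with (C * (e / C)); [|right; field; lra]. apply Rmult_le_compat_l; [lra|].
    eapply Rle_trans; [exact L4|apply Rmin_l]. }
  assert (La : (1 + alpha) * d <= e).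
  { apply Rle_trans with ((1 + alpha) * (e / (1 + alpha))); [|right; field; lra].
    apply Rmult_le_compat_l; [lra|]. eapply Rle_trans; [exact L4|apply Rmin_r]. }
  assert (Lde : d <= e) by nra.
  exists d; split; [exact Hdpos|].
  intros phi' tau0' A' tau' T' s [dphi' [Hbuc' [Htau0' Hcompat']]] Hsol' Hs HT' Hst HdD.
  assert (Hst' := Rabs_def2 _ _ Hst).
  destruct (dD_lt_bounds (Om := Om) alpha phi dphi tau0 phi' dphi' tau0' d Ha) as [B1 [B2 B3]]; auto.
  { apply Hbuc. } { apply Hbuc'. }
  assert (Hsym : forall (u v : pt -> R) r, suple Om (fun x => u x - v x) r ->
            suple Om (fun x => v x - u x) r).
  { intros u v r H x Hx. rewrite Rabs_minus_sym. exact (H x Hx). }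
  assert (Hdep' : forall l, 0 <= l <= s ->
     suple Om (fun x => A' l x - A l x) e /\
     suple Om (fun x => tau' l x - tau l x) e /\
     suple Om (fun x => rhs F A' tau' l x - rhs F A tau l x) e).
  { intros l Hl.
    destruct (Hdep phi' tau0' A' tau' T' d l) as [Q1 [Q2 Q3]].
    - exact Hsol'.
    - apply Htau0'.
    - lra.
    - intros r Hr. apply Hsym, B1, Hr.
    - apply Hsym, B3.
    - lra.
    - apply Tlt_le_trans with s; [lra|exact HT'].
    - repeat split; intros x Hx; (eapply Rle_trans; [|exact LC]); auto. }
  set (dA := glue dphi (rhs F A tau)) in *. set (dA' := glue dphi' (rhs F A' tau')).
  assert (W : forall th, th <= 0 ->
    suple Om (fun x => wt alpha (shift A t) th x - wt alpha (shift A' s) th x) (e + e)).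
  { intros th Hth x Hx. apply Rabs_le_sub with (wt alpha (shift A s) th x).
    - apply K1; auto; lra.
    - apply (wt_shift_diff (Om := Om) alpha A A' s e); auto.
      + intros r Hr y Hy. pose proof (B1 r Hr y Hy) as H. unfold wt in *.
        rewrite (sol_history Hsol), (sol_history Hsol') by assumption. simpl in H. lra.
      + intros r Hr. apply Hsym, Hdep'; lra. }
  assert (dW : forall th, th <= 0 ->
    suple Om (fun x => wt alpha (shift dA t) th x - wt alpha (shift dA' s) th x) (e + e)).
  { intros th Hth x Hx. apply Rabs_le_sub with (wt alpha (shift dA s) th x).
    - apply K2; auto; lra.
    - apply (wt_shift_diff (Om := Om) alpha dA dA' s e); auto.
      + intros r Hr y Hy. pose proof (B2 r Hr y Hy) as H. unfold wt, dA, dA' in *.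
        rewrite !glue_neg by assumption. simpl in H. lra.
      + intros r Hr y Hy. unfold dA, dA'. rewrite !glue_nonneg.
        * rewrite Rabs_minus_sym. apply Hdep'; [lra|exact Hy].
        * apply (history_matches_rhs HO HF Hf Hsol' Hbuc' Htau0' Hcompat'), Hy.
        * lra.
        * apply (history_matches_rhs HO HF Hf Hsol Hbuc Htau0 Hcompat), Hy.
        * lra. }
  intros D D' HD HD'.
  exists (e + e), ((1 + alpha) * (e + e)), (e + e).
  split; [|split; [exact W|split]].
  - assert (E : e * (1 + alpha) = eps / 8) by (unfold e; field; lra). nra.
  - intros th Hth x Hx.
    assert (E1 : D th x = shift dA t th x).
    { apply (hasDeriv_unique (Om := Om) (shift A t) D (shift dA t)); auto.
      apply (sol_shift_hasDeriv HO HF Hf Hsol Hbuc Htau0 Hcompat); exact HT. }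
    assert (E2 : D' th x = shift dA' s th x).
    { apply (hasDeriv_unique (Om := Om) (shift A' s) D' (shift dA' s)); auto.
      apply (sol_shift_hasDeriv HO HF Hf Hsol' Hbuc' Htau0' Hcompat'); exact HT'. }
    unfold dwt. rewrite E1, E2. pose proof (W th Hth x Hx) as F1. pose proof (dW th Hth x Hx) as F2.
    unfold wt in F1, F2. simpl in F1, F2.
    apply Rabs_le_between in F1. apply Rabs_le_between in F2. apply Rabs_le_between.
    split; nra.
  - intros x Hx. apply Rabs_le_sub with (tau s x).
    + rewrite Rabs_minus_sym. apply K3; [|lra|exact Hx]. split; [exact Hs|apply Hin; lra].
    + rewrite Rabs_minus_sym. apply Hdep'; [lra|exact Hx].
Qed.

(** * Density *)

Lemma half_pow_small (B eps : R) : 0 <= B -> 0 < eps -> exists N, forall k, (N <= k)%nat ->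
  B * (1 / 2) ^ k < eps.
Proof.
  intros HB He. destruct (pow_lt_1_zero (1 / 2)) with (y := eps / (B + 1)) as [N HN].
  - rewrite Rabs_pos_eq; lra.
  - apply Rdiv_lt_0_compat; lra.
  - exists N. intros k Hk. specialize (HN k Hk).
    assert (Hp : 0 < (1 / 2) ^ k) by (apply pow_lt; lra).
    rewrite Rabs_pos_eq in HN by lra.
    apply Rle_lt_trans with ((B + 1) * (1 / 2) ^ k); [nra|].
    replace eps with ((B + 1) * (eps / (B + 1))) by (field; lra).
    apply Rmult_lt_compat_l; lra.
Qed.

(** Banach iteration from 0 in the ball of radius [B]. The bound B / 2 on G 0 and the contraction
    factor 1/2 together keep the iterates in the ball. *)
Lemma contraction_fixed_point {n Om} (G : (pt -> R) -> pt -> R) (B : R) :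
  0 <= B ->
  (forall u, contOn n Om u -> suple Om u B -> contOn n Om (G u)) ->
  suple Om (G (fun _ => 0)) (B / 2) ->
  (forall u v a, contOn n Om u -> contOn n Om v -> suple Om u B -> suple Om v B -> 0 <= a ->
     suple Om (fun x => u x - v x) a -> suple Om (fun x => G u x - G v x) (a / 2)) ->
  exists c, contOn n Om c /\ suple Om c B /\ forall x, Om x -> G c x = c x.
Proof.
  intros HB Hcont H0 Hcontr.
  set (u := fun k => Nat.iter k G (fun _ => 0)).
  assert (Hzero : suple Om (fun _ => 0) B) by (intros x _; rewrite Rabs_R0; exact HB).
  assert (Hu : forall k, contOn n Om (u k) /\ suple Om (u k) B).
  { induction k as [|k [IH1 IH2]]; simpl; [split; [apply contOn_const|exact Hzero]|].
    split; [apply Hcont; assumption|]. intros x Hx.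
    replace B with (B / 2 + B / 2) by lra.
    apply Rabs_le_near with (G (fun _ => 0) x); [apply H0, Hx|].
    apply (Hcontr (u k) (fun _ => 0)); auto using contOn_const.
    intros y Hy. rewrite Rminus_0_r. apply IH2, Hy. }
  assert (Hstep : forall k, suple Om (fun x => u (S k) x - u k x) (B / 2 * (1 / 2) ^ k)).
  { induction k as [|k IH].
    - intros x Hx. simpl. rewrite Rminus_0_r, Rmult_1_r. apply H0, Hx.
    - replace (B / 2 * (1 / 2) ^ S k) with (B / 2 * (1 / 2) ^ k / 2) by (simpl; lra).
      apply (Hcontr (u (S k)) (u k)); [apply Hu|apply Hu|apply Hu|apply Hu| |exact IH].
      apply Rmult_le_pos; [lra|]. left; apply pow_lt; lra. }
  (* The telescoping form of the geometric bound is what closes the induction on p. *)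
  assert (Hcauchy : forall k p x, Om x ->
            Rabs (u (k + p)%nat x - u k x) <= B * (1 / 2) ^ k - B * (1 / 2) ^ (k + p)).
  { intros k p x Hx. induction p as [|p IH].
    - rewrite Nat.add_0_r, !Rminus_diag, Rabs_R0. lra.
    - rewrite Nat.add_succ_r. pose proof (Hstep (k + p)%nat x Hx) as H. cbv beta in H.
      pose proof (Rabs_le_sub _ _ _ _ _ H IH) as H'. simpl pow. lra. }
  assert (Htail : forall k p x, Om x -> Rabs (u (k + p)%nat x - u k x) <= B * (1 / 2) ^ k).
  { intros k p x Hx. eapply Rle_trans; [apply Hcauchy, Hx|].
    assert (0 <= B * (1 / 2) ^ (k + p)); [|lra].
    apply Rmult_le_pos; [exact HB|left; apply pow_lt; lra]. }
  assert (Hlim : forall x, Om x -> ex_finite_lim_seq (fun k => u k x)).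
  { intros x Hx. apply ex_lim_seq_cauchy_corr. intros eps.
    destruct (half_pow_small B (eps / 2) HB) as [N HN]; [pose proof (cond_pos eps); lra|].
    exists N. intros i j Hi Hj. specialize (HN N (le_n N)).
    pose proof (Htail N (i - N)%nat x Hx) as E1. pose proof (Htail N (j - N)%nat x Hx) as E2.
    replace (N + (i - N))%nat with i in E1 by lia. replace (N + (j - N))%nat with j in E2 by lia.
    rewrite Rabs_minus_sym in E2. pose proof (Rabs_le_sub _ _ _ _ _ E1 E2). lra. }
  (* Off [Om] this may be a default value, which no later statement sees. *)
  set (c := fun x => real (Lim_seq (fun k => u k x))).
  assert (Hc : forall k, suple Om (fun x => c x - u k x) (B * (1 / 2) ^ k)).
  { intros k x Hx. apply le_epsilon. intros eps He.
    pose proof (Lim_seq_correct' _ (Hlim x Hx)) as L. apply is_lim_seq_Reals in L.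
    destruct (L eps He) as [N HN]. specialize (HN (k + N)%nat ltac:(lia)).
    unfold Rdist in HN. fold (c x) in HN. rewrite Rabs_minus_sym in HN.
    rewrite Rplus_comm. eapply Rabs_le_sub; [left; exact HN|apply Htail, Hx]. }
  assert (Cc : contOn n Om c).
  { apply contOn_uniform_limit. intros eps He.
    destruct (half_pow_small B eps HB He) as [N HN]. exists (u N). split; [apply Hu|].
    intros x Hx. eapply Rle_trans; [apply Hc, Hx|]. left; apply HN; lia. }
  assert (Bc : suple Om c B).
  { intros x Hx. pose proof (Hc 0%nat x Hx) as H. cbv beta in H. unfold u in H. simpl in H.
    rewrite Rminus_0_r, Rmult_1_r in H. exact H. }
  exists c. split; [exact Cc|]. split; [exact Bc|].
  intros x Hx. apply cond_eq. intros eps He.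
  destruct (half_pow_small B eps HB He) as [N HN]. specialize (HN N (le_n N)).
  eapply Rle_lt_trans; [|exact HN].
  replace (B * (1 / 2) ^ N) with (B * (1 / 2) ^ N / 2 + B * (1 / 2) ^ S N) by (simpl; lra).
  apply Rabs_le_sub with (G (u N) x).
  - apply (Hcontr c (u N)); [exact Cc|apply Hu|exact Bc|apply Hu| |apply Hc|exact Hx].
    apply Rmult_le_pos; [exact HB|left; apply pow_lt; lra].
  - rewrite Rabs_minus_sym. apply (Hc (S N) x Hx).
Qed.

(** * Smoothing and differentiation of weighted histories *)

Section Calculus.

Context {n : nat} {Om : pt -> Prop} (HO : Omega_hyp n Om).

Lemma hasDeriv_plus (I : R -> Prop) (phi dphi psi dpsi : R -> pt -> R) :
  hasDeriv Om I phi dphi -> hasDeriv Om I psi dpsi ->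
  hasDeriv Om I (fun t x => phi t x + psi t x) (fun t x => dphi t x + dpsi t x).
Proof.
  intros H1 H2 t Ht eps He.
  destruct (H1 t Ht (eps / 2)) as [d1 [Hd1 K1]]; [lra|].
  destruct (H2 t Ht (eps / 2)) as [d2 [Hd2 K2]]; [lra|].
  exists (Rmin d1 d2); split; [apply Rmin_glb_lt; assumption|]. intros h Hh Hhd HI x Hx.
  specialize (K1 h Hh (Rlt_le_trans _ _ _ Hhd (Rmin_l _ _)) HI x Hx).
  specialize (K2 h Hh (Rlt_le_trans _ _ _ Hhd (Rmin_r _ _)) HI x Hx). cbv beta in *.
  replace ((phi (t + h) x + psi (t + h) x - (phi t x + psi t x)) / h - (dphi t x + dpsi t x))
    with (((phi (t + h) x - phi t x) / h - dphi t x) +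
          ((psi (t + h) x - psi t x) / h - dpsi t x)) by (field; exact Hh).
  eapply Rle_trans; [apply Rabs_triang|lra].
Qed.

Lemma hasDeriv_mult (I : R -> Prop) (g dg : R -> R) (phi dphi : R -> pt -> R) :
  (forall t, is_derive g t (dg t)) -> (forall t, I t -> contOn n Om (phi t)) ->
  (forall t, I t -> contOn n Om (dphi t)) -> hasDeriv Om I phi dphi ->
  hasDeriv Om I (fun t x => g t * phi t x) (fun t x => dg t * phi t x + g t * dphi t x).
Proof.
  intros Hg C1 C2 H t Ht eps He.
  destruct (contOn_bounded _ HO (C1 t Ht)) as [M1 [HM1 B1]].
  destruct (contOn_bounded _ HO (C2 t Ht)) as [M2 [HM2 B2]].
  pose proof (Rabs_pos (g t)) as Hp.
  set (e := eps / (3 * (Rabs (g t) + 1 + M1 + M2))).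
  assert (Hee : 0 < e) by (apply Rdiv_lt_0_compat; lra).
  destruct (H t Ht e Hee) as [d1 [Hd1 K1]].
  destruct (proj1 (is_derive_Reals _ _ _) (Hg t) e Hee) as [d2 K2].
  assert (Cg : continuous g t) by (apply (ex_derive_continuous g); exists (dg t); apply Hg).
  assert (He3 : 0 < Rmin 1 e) by (apply Rmin_glb_lt; lra).
  destruct (proj1 (filterlim_locally g (g t)) Cg (mkposreal _ He3)) as [d3 K3].
  exists (Rmin d1 (Rmin d2 d3)).
  split; [repeat apply Rmin_glb_lt; try assumption; apply cond_pos|].
  intros h Hh Hhd HI x Hx.
  pose proof (Rlt_le_trans _ _ _ Hhd (Rmin_l _ _)) as E1.
  pose proof (Rlt_le_trans _ _ _ Hhd (Rmin_r _ _)) as E.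
  specialize (K1 h Hh E1 HI x Hx). cbv beta in K1.
  specialize (K2 h Hh (Rlt_le_trans _ _ _ E (Rmin_l _ _))).
  assert (K3' : Rabs (g (t + h) - g t) < Rmin 1 e).
  { apply (K3 (t + h)). change (Rabs (t + h - t) < d3). replace (t + h - t) with h by ring.
    eapply Rlt_le_trans; [exact E|apply Rmin_r]. }
  pose proof (Rlt_le_trans _ _ _ K3' (Rmin_l _ _)) as E3.
  pose proof (Rlt_le_trans _ _ _ K3' (Rmin_r _ _)) as E4.
  assert (Hgh : Rabs (g (t + h)) <= Rabs (g t) + 1) by (eapply Rabs_le_near; [apply Rle_refl|lra]).
  replace ((g (t + h) * phi (t + h) x - g t * phi t x) / h - (dg t * phi t x + g t * dphi t x))
    with (g (t + h) * ((phi (t + h) x - phi t x) / h - dphi t x) +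
          (g (t + h) - g t) * dphi t x + ((g (t + h) - g t) / h - dg t) * phi t x)
    by (field; exact Hh).
  eapply Rle_trans; [apply Rabs_triang|].
  eapply Rle_trans; [apply Rplus_le_compat_r, Rabs_triang|].
  pose proof (Rabs_mult_le _ _ _ _ Hgh K1) as F1.
  pose proof (Rabs_mult_le _ _ _ _ (Rlt_le _ _ E4) (B2 x Hx)) as F2.
  pose proof (Rabs_mult_le _ _ _ _ (Rlt_le _ _ K2) (B1 x Hx)) as F3.
  assert (Ee : (Rabs (g t) + 1) * e + e * M2 + e * M1 = eps / 3).
  { unfold e; field. lra. }
  lra.
Qed.

Lemma BUCfun_separable (g : R -> R) (c : pt -> R) (Mg Lg : R) :
  (forall t, Rabs (g t) <= Mg) -> (forall s t, Rabs (g s - g t) <= Lg * Rabs (s - t)) ->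
  contOn n Om c -> BUCfun n Om (fun t x => g t * c x).
Proof.
  intros Hg HL Hc. destruct (contOn_bounded c HO Hc) as [M [HM HMc]].
  split; [intros; apply contOn_scal, Hc|split].
  - exists (Mg * M). intros t _ x Hx. apply Rabs_mult_le; auto.
  - intros eps He. pose proof (Rabs_pos Lg). set (Q := Rabs Lg * M + 1).
    assert (HQ : 0 < Q) by (unfold Q; nra).
    exists (eps / Q). split; [apply Rdiv_lt_0_compat; lra|].
    intros s t _ _ Hst x Hx. rewrite <- Rmult_minus_distr_r.
    pose proof (Rabs_pos (s - t)).
    assert (E : Rabs (g s - g t) <= Rabs Lg * Rabs (s - t)).
    { eapply Rle_trans; [apply HL|]. apply Rmult_le_compat_r; [lra|apply RRle_abs]. }
    eapply Rle_trans; [apply (Rabs_mult_le _ _ _ _ E (HMc x Hx))|].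
    apply Rle_trans with (Q * Rabs (s - t)); [unfold Q; nra|].
    apply Rle_trans with (Q * (eps / Q)); [apply Rmult_le_compat_l; lra|right; field; lra].
Qed.

(** Backward Steklov averages, taken after extending [W] by the constant [W 0] to positive
    times. *)
Lemma BUCfun_smoothing (W : R -> pt -> R) (eps : R) : BUCfun n Om W -> 0 < eps ->
  exists V dV, BUCfun n Om V /\ BUCfun n Om dV /\ hasDeriv Om Ineg V dV /\
    forall t, t <= 0 -> suple Om (fun x => V t x - W t x) eps.
Proof.
  intros HW He. pose proof HW as [H1 [[M HM] H3]].
  destruct (H3 eps He) as [d [Hd Hunif]].
  (* Half the modulus, so that every time in the averaging window is strictly within [d] of t. *)
  set (h := d / 2). assert (Hh : 0 < h) by (unfold h; lra).
  (* The extension gives two-sided continuity at 0, from which integrability up to 0 follows. *)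
  set (W0 := fun s => W (Rmin s 0)).
  assert (Hmin : forall s, Rmin s 0 <= 0) by (intros; apply Rmin_r).
  assert (EW : forall t x, t <= 0 -> W0 t x = W t x).
  { intros t x Ht. unfold W0. rewrite Rmin_left; auto. }
  assert (CW : contC n Om (fun _ => True) W0).
  { split; [intros t _; apply H1, Hmin|]. intros t _ e Hee.
    destruct (H3 e Hee) as [d' [Hd' K]]. exists d'; split; [exact Hd'|].
    intros s _ Hst. apply K; auto. eapply Rle_lt_trans; [|exact Hst].
    unfold Rmin, Rabs. repeat destruct Rle_dec; repeat destruct Rcase_abs; lra. }
  assert (IW : forall s t x, Om x -> ex_RInt (fun r => W0 r x) s t).
  { intros s t x Hx. apply (ex_RInt_continuous (fun r => W0 r x)). intros z _.
    apply (contC_continuous (n := n) (Om := Om) (fun _ => True) W0); auto.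
    exists (mkposreal 1 Rlt_0_1); auto. }
  set (P := fun t x => RInt (fun r => W0 r x) 0 t).
  assert (HP : forall s t x, Om x -> is_RInt (fun r => W0 r x) s t (P t x - P s x)).
  { intros s t x Hx. apply is_RInt_sub with 0; apply (RInt_correct (fun r => W0 r x)); auto. }
  set (V := fun t x => / h * (P t x - P (t - h) x)).
  set (dV := fun t x => / h * W t x + / h * (- 1 * W (t - h) x)).
  assert (HV : forall t x r, Om x -> P t x - P (t - h) x - r * h = (V t x - r) * h).
  { intros t x r Hx. unfold V. field. lra. }
  assert (avg : forall t x r e, Om x ->
     (forall s, t - h <= s <= t -> Rabs (W0 s x - r) <= e) -> Rabs (V t x - r) <= e).
  { intros t x r e Hx H.
    pose proof (RInt_dist_const _ _ _ _ r e (HP (t - h) t x Hx)) as K.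
    rewrite Rmin_left, Rmax_right in K by lra. specialize (K H).
    replace (t - (t - h)) with h in K by ring. rewrite HV in K by exact Hx.
    rewrite Rabs_mult, (Rabs_pos_eq h) in K by lra.
    apply Rmult_le_reg_r with h; assumption. }
  assert (HdV : BUCfun n Om dV).
  { apply (BUCfun_plus (fun t x => / h * W t x)); [apply BUCfun_scal, HW|].
    apply BUCfun_scal, BUCfun_scal. split; [intros; apply H1; lra|split].
    - exists M. intros t Ht. apply HM; lra.
    - intros e Hee. destruct (H3 e Hee) as [d' [Hd' K]]. exists d'; split; [exact Hd'|].
      intros s t Hs Ht Hst. apply K; [lra|lra|].
      replace (s - h - (t - h)) with (s - t) by ring. exact Hst. }
  exists V, dV. split; [|split; [exact HdV|split]].
  - split; [|split].
    + intros t Ht x Hx e Hee.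
      destruct (contC_equicont _ W0 (t - h) t CW (fun _ _ => Logic.I) x (e / 2) Hx)
        as [d' [Hd' K]]; [lra|].
      exists d'; split; [exact Hd'|]. intros y Hy Hn. apply Rle_lt_trans with (e / 2); [|lra].
      pose proof (is_RInt_minus _ _ _ _ _ _ (HP (t - h) t y Hy) (HP (t - h) t x Hx)) as I1.
      apply (RInt_bound _ _ _ _ (e / 2)) in I1.
      * change (Rabs (P t y - P (t - h) y - (P t x - P (t - h) x)) <= e / 2 * Rabs (t - (t - h)))
          in I1.
        replace (t - (t - h)) with h in I1 by ring. rewrite (Rabs_pos_eq h) in I1 by lra.
        unfold V. rewrite <- Rmult_minus_distr_l, Rabs_mult, (Rabs_pos_eq (/ h))
          by (left; apply Rinv_0_lt_compat; lra).
        apply Rmult_le_reg_l with h; [exact Hh|]. rewrite <- Rmult_assoc, Rinv_r by lra. lra.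
      * intros s Hs. rewrite Rmin_left, Rmax_right in Hs by lra. apply (K y s); auto.
    + exists M. intros t Ht x Hx. rewrite <- (Rminus_0_r (V t x)). apply avg; [exact Hx|].
      intros s _. rewrite Rminus_0_r. apply HM; auto.
    (* The average is Lipschitz in time with constant 2 |M| / h, both ends of its window moving. *)
    + intros e Hee. set (Q := 2 * Rabs M / h + 1).
      assert (HQ : 0 < Q).
      { unfold Q. pose proof (Rabs_pos M).
        assert (0 <= 2 * Rabs M / h); [|lra].
        apply Rmult_le_pos; [lra|left; apply Rinv_0_lt_compat; lra]. }
      exists (e / Q). split; [apply Rdiv_lt_0_compat; lra|].
      intros s t Hs Ht Hst x Hx.
      assert (bound : forall a b, Rabs (P b x - P a x) <= Rabs M * Rabs (b - a)).
      { intros a b. apply (RInt_bound (fun r => W0 r x)); [apply HP, Hx|].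
        intros r _. eapply Rle_trans; [apply HM; auto|apply RRle_abs]. }
      pose proof (bound t s) as E1. pose proof (bound (t - h) (s - h)) as E2.
      replace (s - h - (t - h)) with (s - t) in E2 by ring. rewrite <- Rabs_Ropp in E2.
      pose proof (Rplus_le_compat _ _ _ _ E1 E2) as E3.
      pose proof (Rle_trans _ _ _ (Rabs_triang _ _) E3) as E4.
      replace (V s x - V t x)
        with (/ h * (P s x - P t x + - (P (s - h) x - P (t - h) x))) by (unfold V; ring).
      rewrite Rabs_mult, (Rabs_pos_eq (/ h)) by (left; apply Rinv_0_lt_compat; lra).
      apply Rle_trans with (/ h * (Rabs M * Rabs (s - t) + Rabs M * Rabs (s - t))).
      { apply Rmult_le_compat_l; [left; apply Rinv_0_lt_compat; lra|exact E4]. }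
      apply Rle_trans with (Q * Rabs (s - t)).
      { unfold Q. pose proof (Rabs_pos (s - t)). unfold Rdiv. nra. }
      apply Rle_trans with (Q * (e / Q)); [apply Rmult_le_compat_l; lra|right; field; lra].
  - apply (hasDeriv_of_integral (n := n)).
    + intros s r t Hs Ht Hr. unfold Ineg in *. revert Hr. unfold Rmax; destruct Rle_dec; lra.
    + intros s t x Hs Ht Hx.
      assert (I2 : is_RInt (fun r => W0 (r - h) x) s t (P (t - h) x - P (s - h) x)).
      { apply is_RInt_ext with (fun r => scal 1 (W0 (1 * r + - h) x)).
        - intros r _. rewrite Rmult_1_l. unfold scal; simpl; unfold mult; simpl.
          rewrite Rmult_1_l. reflexivity.
        - apply (is_RInt_comp_lin (fun r => W0 r x)). rewrite !Rmult_1_l. apply HP, Hx. }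
      pose proof (is_RInt_scal _ _ _ (/ h) _ (is_RInt_minus _ _ _ _ _ _ (HP s t x Hx) I2)) as I3.
      replace (V t x - V s x)
        with (scal (/ h) (minus (P t x - P s x) (P (t - h) x - P (s - h) x))).
      * eapply is_RInt_ext; [|exact I3]. intros r Hr.
        assert (Hr0 : r <= 0).
        { unfold Ineg in *. revert Hr. unfold Rmax; destruct Rle_dec; lra. }
        unfold scal, minus, plus, opp; simpl; unfold mult; simpl.
        unfold dV. rewrite !EW by lra. ring.
      * unfold scal, minus, plus, opp; simpl; unfold mult; simpl. unfold V. ring.
    + apply BUCfun_contC, HdV.
  - intros t Ht x Hx. apply avg; [exact Hx|]. intros s Hs. rewrite EW by lra.
    apply Hunif; [lra|lra| |exact Hx]. unfold h in Hs. apply Rabs_def1; lra.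
Qed.

Lemma is_derive_exp_lin (a t : R) : is_derive (fun s => exp (- a * s)) t (- a * exp (- a * t)).
Proof. auto_derive; [exact I|]. ring. Qed.

Lemma wt_exp (alpha : R) (U : R -> pt -> R) (t : R) (x : pt) : t <= 0 ->
  wt alpha (fun t x => exp (- alpha * t) * U t x) t x = U t x.
Proof.
  intros Ht. unfold wt. rewrite exp_weight_nonpos by exact Ht.
  rewrite <- Rmult_assoc, <- exp_plus.
  replace (alpha * t + - alpha * t) with 0 by ring. rewrite exp_0. ring.
Qed.

(** The factor exp(-alpha t) cancels the weight exactly, so smoothing and correction can be done on
    unweighted functions. *)
Lemma BUC1_of_weighted (alpha : R) (U dU : R -> pt -> R) :
  BUCfun n Om U -> BUCfun n Om dU -> hasDeriv Om Ineg U dU ->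
  BUC1 n Om alpha (fun t x => exp (- alpha * t) * U t x)
    (fun t x => - alpha * exp (- alpha * t) * U t x + exp (- alpha * t) * dU t x).
Proof.
  intros HU HdU Hder.
  assert (Cexp : forall t, continuous (fun t => exp (- alpha * t)) t).
  { intros t. apply (ex_derive_continuous (fun t => exp (- alpha * t))).
    exists (- alpha * exp (- alpha * t)). apply is_derive_exp_lin. }
  assert (CU : contC n Om Ineg (fun t x => exp (- alpha * t) * U t x)).
  { apply contC_scal; [exact HO|intros; apply Cexp|apply BUCfun_contC, HU]. }
  split; [exact CU|]. split; [|split; [|split]].
  - apply hasDeriv_mult; [apply is_derive_exp_lin|apply HU|apply HdU|exact Hder].
  - apply contC_plus.
    + apply contC_ext with (fun t x => - alpha * (exp (- alpha * t) * U t x)).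
      { intros; ring. }
      apply (contC_scal Ineg (fun _ => - alpha)); [exact HO|intros; apply continuous_const|exact CU].
    + apply contC_scal; [exact HO|intros; apply Cexp|apply BUCfun_contC, HdU].
  - apply BUCfun_ext with U; [|exact HU]. intros. symmetry. apply wt_exp; assumption.
  - apply BUCfun_ext with dU; [|exact HdU]. intros t x Ht Hx.
    rewrite dwt_split, wt_exp by exact Ht.
    rewrite <- (wt_exp alpha dU t x Ht). rewrite <- (wt_exp alpha U t x Ht) at 1.
    unfold wt. ring.
Qed.

End Calculus.

Lemma lipschitz_of_derive (g dg : R -> R) (L : R) :
  (forall t, is_derive g t (dg t)) -> (forall t, Rabs (dg t) <= L) ->
  forall s t, Rabs (g s - g t) <= L * Rabs (s - t).
Proof.
  intros H HL s t. destruct (MVT_gen g t s dg) as [c [_ E]].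
  - intros; apply H.
  - intros r _. apply continuity_pt_filterlim, (ex_derive_continuous g). exists (dg r); apply H.
  - rewrite E, Rabs_mult. apply Rmult_le_compat_r; [apply Rabs_pos|apply HL].
Qed.

(** After smoothing [psi], the compatibility condition at [t = 0] is restored by adding
    [k sin (t / k) c(x)] to the weighted history: this is small, vanishes at [0] and has derivative
    [c] there.  As the perturbation also changes the delayed argument of [F], the corrector [c]
    is a fixed point, of a contraction when [k] is small. *)
Lemma D_dense {n Om} (alpha : R) (F : Ftype) (tau0 : pt -> R) (psi : R -> pt -> R) (eps : R) :
  Omega_hyp n Om -> 0 <= alpha -> F_hyp n Om F -> Cplus n Om tau0 -> BUC n Om alpha psi ->
  eps > 0 -> exists phi, InD n Om F alpha phi tau0 /\ dBUC_lt Om alpha phi psi eps.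
Proof.
  intros HO Ha HF [Ctau Htau] [_ Hpsi] He.
  destruct (BUCfun_smoothing (wt alpha psi) (eps / 4) Hpsi ltac:(lra))
    as [V [dV [HV [HdV [Hder Hclose]]]]].
  destruct (contOn_bounded tau0 HO Ctau) as [H [HH Htau0H]].
  assert (HtauH : forall x, Om x -> 0 <= tau0 x <= H).
  { intros x Hx. pose proof (Htau x Hx). pose proof (Htau0H x Hx) as Q.
    rewrite Rabs_pos_eq in Q; lra. }
  destruct HV as [HV1 [[MV' HMV'] HV3]].
  set (MV := Rabs MV').
  assert (HMV : forall t, t <= 0 -> suple Om (V t) MV).
  { intros t Ht x Hx. eapply Rle_trans; [apply HMV'; assumption|apply RRle_abs]. }
  assert (HV : BUCfun n Om V) by (split; [exact HV1|split; [exists MV'; exact HMV'|exact HV3]]).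
  assert (HMVpos : 0 <= MV) by apply Rabs_pos.
  set (E := exp (alpha * H)).
  assert (HE : 1 <= E).
  { unfold E. pose proof (exp_ineq1_le (alpha * H)). nra. }
  (* Bounds every argument of [F] for all correctors in the ball: [E] undoes the weight on [-H, 0],
     MV + 1 bounds the corrected weighted history once k B <= 1, and [H] bounds the delay. *)
  set (K := E * (MV + 1) + H).
  assert (HK : 0 <= K) by (unfold K; nra).
  destruct (F_lipschitz F HF K) as [L [HL HFlip]].
  assert (Z2 : contOn2 n Om (fun _ _ => 0)).
  { intros x y _ _ e Hee. exists 1; split; [lra|]. intros. rewrite Rminus_diag, Rabs_R0. exact Hee. }
  assert (Zadm : admissible (n := n) (Om := Om) K (fun _ => 0) (fun _ => 0) (fun _ _ => 0)).
  { split; [apply contOn_const|]. split; [apply contOn_const|]. split; [exact Z2|].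
    repeat split; repeat intro; rewrite Rabs_R0; exact HK. }
  (* The derivative at 0 of the uncorrected history. With corrector c it becomes r0 + c, so
     compatibility reads c = F(...) - r0. *)
  set (r0 := fun x => dV 0 x + - alpha * V 0 x).
  assert (Cr0 : contOn n Om r0).
  { apply contOn_plus; [apply HdV; lra|apply contOn_scal, HV; lra]. }
  destruct (contOn_bounded r0 HO Cr0) as [S1 [HS1 HS1']].
  destruct (contOn_bounded (F (fun _ => 0) (fun _ => 0) (fun _ _ => 0)) HO) as [S2 [HS2 HS2']].
  { apply HF; [apply contOn_const|apply contOn_const|exact Z2]. }
  (* Twice the bound on G 0, as [contraction_fixed_point] requires: [F] at zero arguments, its
     variation over the range [K], and [r0]. *)
  set (B := 2 * (S2 + L * K + S1)).
  assert (HB : 0 <= B) by (unfold B; nra).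
  (* The three bounds serve in turn the range [K] (k B <= 1), the distance to [psi] (k B <= eps / 4)
     and the contraction (L E k <= 1/2). *)
  set (k := Rmin (/ (B + 1)) (Rmin (eps / (4 * (B + 1))) (/ (2 * (L * E))))).
  assert (HLE : 0 < L * E) by nra.
  assert (Hk : 0 < k).
  { unfold k. repeat apply Rmin_glb_lt.
    - apply Rinv_0_lt_compat; lra.
    - apply Rdiv_lt_0_compat; lra.
    - apply Rinv_0_lt_compat; lra. }
  assert (HkB : k * B <= 1 /\ k * B <= eps / 4).
  { split.
    - apply Rle_trans with (/ (B + 1) * (B + 1)).
      + apply Rmult_le_compat; [lra|lra|apply Rmin_l|lra].
      + right; field; lra.
    - apply Rle_trans with (eps / (4 * (B + 1)) * (B + 1)).
      + apply Rmult_le_compat; [lra|lra| |lra].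
        eapply Rle_trans; [apply Rmin_r|apply Rmin_l].
      + right; field; lra. }
  assert (HkL : L * (E * k) <= / 2).
  { rewrite <- Rmult_assoc. apply Rle_trans with (L * E * / (2 * (L * E))).
    - apply Rmult_le_compat_l; [lra|]. eapply Rle_trans; [apply Rmin_r|apply Rmin_r].
    - right; field. split; nra. }
  set (g := fun t => k * sin (t / k)).
  assert (Hg : forall t, is_derive g t (cos (t / k))).
  { intros t. unfold g. auto_derive; [exact I|]. fold (t / k).
    rewrite Rmult_1_l, <- Rmult_assoc, Rinv_r by lra. ring. }
  assert (Hg' : forall t, is_derive (fun t => cos (t / k)) t (- sin (t / k) / k)).
  { intros t. auto_derive; [exact I|]. fold (t / k). unfold Rdiv at 2. ring. }
  assert (Hsin : forall t, Rabs (sin t) <= 1).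
  { intros t. apply Rabs_le_between. pose proof (SIN_bound t). lra. }
  assert (Hcos : forall t, Rabs (cos t) <= 1).
  { intros t. apply Rabs_le_between. pose proof (COS_bound t). lra. }
  assert (Hgk : forall t, Rabs (g t) <= k).
  { intros t. unfold g. rewrite Rabs_mult, (Rabs_pos_eq k) by lra.
    pose proof (Hsin (t / k)). nra. }
  assert (Hg0 : g 0 = 0) by (unfold g, Rdiv; rewrite Rmult_0_l, sin_0; ring).
  set (U := fun (c : pt -> R) t x => V t x + g t * c x).
  set (dU := fun (c : pt -> R) t x => dV t x + cos (t / k) * c x).
  set (phi := fun (c : pt -> R) t x => exp (- alpha * t) * U c t x).
  assert (HUB : forall c, contOn n Om c -> BUCfun n Om (U c)).
  { intros c Hc. apply BUCfun_plus; [exact HV|].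
    apply (BUCfun_separable HO g c k 1); [exact Hgk| |exact Hc].
    apply (lipschitz_of_derive g (fun t => cos (t / k))); [exact Hg|intros; apply Hcos]. }
  assert (HdUB : forall c, contOn n Om c -> BUCfun n Om (dU c)).
  { intros c Hc. apply BUCfun_plus; [exact HdV|].
    apply (BUCfun_separable HO (fun t => cos (t / k)) c 1 (/ k)); [intros; apply Hcos| |exact Hc].
    apply (lipschitz_of_derive _ (fun t => - sin (t / k) / k)); [exact Hg'|].
    intros t. unfold Rdiv at 1. rewrite Rabs_mult, Rabs_Ropp, (Rabs_pos_eq (/ k))
      by (left; apply Rinv_0_lt_compat; lra).
    rewrite <- (Rmult_1_l (/ k)) at 2. apply Rmult_le_compat_r;
      [left; apply Rinv_0_lt_compat; lra|apply Hsin]. }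
  assert (HUder : forall c, contOn n Om c -> hasDeriv Om Ineg (U c) (dU c)).
  { intros c Hc. apply hasDeriv_plus; [exact Hder|].
    apply hasDeriv_ext with (fun t x => g t * c x) (fun t x => cos (t / k) * c x + g t * 0);
      [reflexivity|intros; ring|].
    apply (hasDeriv_mult HO Ineg g (fun t => cos (t / k)) (fun _ => c) (fun _ _ => 0)); auto.
    - intros; apply contOn_const.
    - intros t _ e Hee. exists 1; split; [lra|]. intros h Hh _ _ x _.
      replace ((c x - c x) / h - 0) with 0 by (field; exact Hh). rewrite Rabs_R0; lra. }
  assert (Hphi : forall c, contOn n Om c -> BUC1 n Om alpha (phi c)
    (fun t x => - alpha * exp (- alpha * t) * U c t x + exp (- alpha * t) * dU c t x)).
  { intros c Hc. apply BUC1_of_weighted; auto. }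
  assert (Hexp : forall t, - H <= t <= 0 -> Rabs (exp (- alpha * t)) <= E).
  { intros t Ht. rewrite Rabs_pos_eq by (left; apply exp_pos).
    destruct (Req_dec (- alpha * t) (alpha * H)) as [->|Hn]; [apply Rle_refl|].
    left; apply exp_increasing. nra. }
  assert (HphiK : forall c t, suple Om c B -> - H <= t <= 0 -> suple Om (phi c t) K).
  { intros c t Hc Ht x Hx. apply Rle_trans with (E * (MV + 1)); [|unfold K; lra].
    apply Rabs_mult_le; [apply Hexp, Ht|]. eapply Rle_trans; [apply Rabs_triang|].
    apply Rplus_le_compat; [apply HMV; [lra|exact Hx]|].
    eapply Rle_trans; [apply (Rabs_mult_le _ _ _ _ (Hgk t) (Hc x Hx))|apply HkB]. }
  assert (Hadm : forall c, contOn n Om c -> suple Om c B ->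
            admissible (n := n) (Om := Om) K (phi c 0) tau0 (delayed (phi c) tau0)).
  { intros c Hc HcB. split; [apply (Hphi c Hc); unfold Ineg; lra|]. split; [exact Ctau|].
    split; [|split; [|split]].
    - apply (contOn2_evaluation Ineg (phi c) (fun y => - tau0 y)).
      + apply (Hphi c Hc).
      + apply contOn_ext with (fun y => -1 * tau0 y); [intros; ring|]. apply contOn_scal, Ctau.
      + intros x Hx. specialize (HtauH x Hx). unfold Ineg; lra.
    - apply HphiK; [exact HcB|lra].
    - intros x Hx. eapply Rle_trans; [apply Htau0H, Hx|]. unfold K. nra.
    - intros x y Hx Hy. specialize (HtauH x Hx). apply HphiK; auto. lra. }
  set (G := fun c x => F (phi c 0) tau0 (delayed (phi c) tau0) x - r0 x).
  destruct (contraction_fixed_point (n := n) (Om := Om) G B HB) as [c [Cc [Bc Ec]]].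
  - intros c Hc HcB. destruct (Hadm c Hc HcB) as (a1 & a2 & a3 & _).
    apply contOn_minus; [apply HF; assumption|exact Cr0].
  - intros x Hx. unfold G.
    assert (Zc : suple Om (fun _ => 0) B) by (intros y _; rewrite Rabs_R0; exact HB).
    pose proof (Hadm (fun _ => 0) (contOn_const 0) Zc) as adm0.
    assert (Q : Rabs (F (phi (fun _ => 0) 0) tau0 (delayed (phi (fun _ => 0)) tau0) x)
                <= S2 + L * K).
    { apply Rabs_le_near with (F (fun _ => 0) (fun _ => 0) (fun _ _ => 0) x); [apply HS2', Hx|].
      apply HFlip; auto. destruct adm0 as (_ & _ & _ & b1 & b2 & b3).
      repeat split; repeat intro; rewrite Rminus_0_r; auto. }
    unfold B. replace (2 * (S2 + L * K + S1) / 2) with (S2 + L * K + S1) by field.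
    apply Rabs_le_near with (F (phi (fun _ => 0) 0) tau0 (delayed (phi (fun _ => 0)) tau0) x);
      [exact Q|].
    rewrite Rabs_minus_sym.
    match goal with |- Rabs (?p - (?p - ?q)) <= _ => replace (p - (p - q)) with q by ring end.
    apply HS1', Hx.
  - intros u v a Cu Cv Bu Bv Hapos Huv x Hx. unfold G.
    match goal with |- Rabs (?p - ?r - (?q - ?r)) <= _ =>
      replace (p - r - (q - r)) with (p - q) by ring end.
    apply Rle_trans with (L * (E * k * a)); [|nra].
    (* [V] cancels, so the corrector acts only through g, which has size at most k. *)
    assert (Hdiff : forall t y, - H <= t <= 0 -> Om y ->
              Rabs (phi u t y - phi v t y) <= E * k * a).
    { intros t y Ht Hy.
      replace (phi u t y - phi v t y) with (exp (- alpha * t) * (g t * (u y - v y)))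
        by (unfold phi, U; ring).
      rewrite Rmult_assoc. apply Rabs_mult_le; [apply Hexp, Ht|].
      apply Rabs_mult_le; [apply Hgk|apply Huv, Hy]. }
    assert (HEka : 0 <= E * k * a) by (apply Rmult_le_pos; nra).
    apply HFlip; auto. repeat split.
    + intros y Hy. apply Hdiff; [lra|exact Hy].
    + intros y Hy. rewrite Rminus_diag, Rabs_R0. exact HEka.
    + intros y z Hy Hz. specialize (HtauH y Hy). apply Hdiff; [lra|exact Hz].
  - exists (phi c). split.
    + eexists. split; [apply Hphi, Cc|]. split; [split; assumption|].
      intros x Hx. pose proof (Ec x Hx) as Q. unfold G, r0 in Q.
      unfold U, dU. rewrite Hg0. replace (0 / k) with 0 by (field; lra).
      rewrite cos_0, Rmult_0_r, exp_0. lra.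
    + exists (eps / 4 + k * B). split; [lra|]. intros t Ht x Hx.
      rewrite (wt_exp alpha (U c)) by exact Ht. unfold U.
      replace (V t x + g t * c x - wt alpha psi t x)
        with ((V t x - wt alpha psi t x) + g t * c x) by ring.
      eapply Rle_trans; [apply Rabs_triang|]. apply Rplus_le_compat; [apply Hclose; assumption|].
      apply Rabs_mult_le; [apply Hgk|apply Bc, Hx].
Qed.

(** * Assembly of density, invariance and continuity *)

Theorem theorem1p7 (n : nat) (Om : pt -> Prop) (alpha Mf : R)
  (F : Ftype) (f : (pt -> R) -> (pt -> R)) :
  Omega_hyp n Om -> 0 <= alpha -> F_hyp n Om F -> f_hyp n Om f Mf ->
  (* (a) *)
  ((forall tau0, Cplus n Om tau0 ->
      forall psi, BUC n Om alpha psi -> forall eps, eps > 0 ->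
        exists phi, InD n Om F alpha phi tau0 /\ dBUC_lt Om alpha phi psi eps)
   /\ (forall phi tau0, InD n Om F alpha phi tau0 -> BUC n Om alpha phi /\ Cplus n Om tau0)
   /\ (forall psi tau, BUC n Om alpha psi -> Cplus n Om tau ->
        forall eps, eps > 0 -> exists phi tau0,
          InD n Om F alpha phi tau0 /\ dBUC_lt Om alpha phi psi eps /\ dC_lt Om tau0 tau eps))
  /\
  (* (b) *)
  (forall phi tau0 A tau T,
     InD n Om F alpha phi tau0 -> max_solution n Om F f phi tau0 A tau T ->
     forall t, 0 <= t -> Tlt t T -> InD n Om F alpha (shift A t) (tau t))
  /\
  (* (c) *)
  (forall phi tau0 A tau T t,
     InD n Om F alpha phi tau0 -> max_solution n Om F f phi tau0 A tau T ->
     0 <= t -> Tlt t T ->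
     forall eps, eps > 0 -> exists d, d > 0 /\
       forall phi' tau0' A' tau' T' s,
         InD n Om F alpha phi' tau0' -> max_solution n Om F f phi' tau0' A' tau' T' ->
         0 <= s -> Tlt s T' -> Rabs (s - t) < d ->
         dD_lt Om alpha phi tau0 phi' tau0' d ->
         dD_lt Om alpha (shift A t) (tau t) (shift A' s) (tau' s) eps).
Proof.
  intros HO Ha HF Hf. split; [split; [|split]|split].
  - intros tau0 Htau0 psi Hpsi eps He. eapply D_dense; eassumption.
  - intros phi tau0 [dphi [Hphi [Htau0 _]]]. split; [split; apply Hphi|exact Htau0].
  - intros psi tau Hpsi Htau eps He.
    destruct (D_dense alpha F tau psi eps HO Ha HF Htau Hpsi He) as [phi [H1 H2]].
    (* Density holds in each fibre, so the delay component is kept unchanged. *)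
    exists phi, tau. split; [exact H1|]. split; [exact H2|].
    exists (eps / 2). split; [lra|]. intros x _. rewrite Rminus_diag, Rabs_R0. lra.
  - intros phi tau0 A tau T [dphi [Hbuc [Htau0 Hcompat]]] [Hsol _].
    exact (sol_InD HO HF Hf Hsol Hbuc Htau0 Hcompat).
  - intros phi tau0 A tau T t HD [Hsol _] Ht HT eps He.
    destruct (semiflow_continuous phi tau0 A tau T t HO Ha HF Hf HD Hsol Ht HT eps He)
      as [d [Hd K]].
    exists d; split; [exact Hd|]. intros phi' tau0' A' tau' T' s HD' [Hsol' _].
    apply (K phi' tau0' A' tau' T' s HD' Hsol').
Qed.
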